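(* Let $B$ be a Boolean algebra and $\lambda$ an infinite cardinal with $\pi(B)>\lambda$, and assume one of the following: (A) $\mathrm{cf}(\lambda)=\aleph_0$; or (B) $\mu^{<\mathrm{cf}(\lambda)}<\lambda$ for every cardinal $\mu<\lambda$; or (C) $2^\mu<\pi(B)$ for every cardinal $\mu<\lambda$ (or merely $2^\mu<|B|$ for every cardinal $\mu<\lambda$). Then $B$ has a subalgebra $B'$ with $\lambda=\pi(B')=|B'|$.
   Context: For a Boolean algebra $B$, $B^+=B\setminus\{0\}$, and the algebraic density is $\pi(B)=\min\{|X|:X\subseteq B^+,\ \forall y\in B^+\exists x\in X\ (x\le y)\}$. *)

(* Defs.v *)
From HB Require Import structures.
From mathcomp Require Import all_boot all_order.
From mathcomp Require Import boolp contra wochoice classical_sets functions.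
From mathcomp Require Import cardinality.

Set Implicit Arguments.
Unset Strict Implicit.
Unset Printing Implicit Defensive.
Import Order.TTheory.

Local Open Scope classical_set_scope.
Local Open Scope card_scope.

(* Cardinals are represented by sets up to equipotence [#=]. *)
Definition card_lt T U (A : set T) (B : set U) := A #<= B /\ ~ (B #<= A).
Notation "A '#<' B" := (card_lt A B) (at level 79) : card_scope.

(* A member of F of least cardinality, standing for min {|X| : X in F};
   it exists as soon as F is nonempty: see [min_cardP] below. *)
Definition min_card T (F : set (set T)) : set T :=
  xget set0 [set X | F X /\ forall Y, F Y -> X #<= Y].

Lemma min_card_ex T (F : set (set T)) :
  F !=set0 -> exists2 X, F X & forall Y, F Y -> X #<= Y.
Proof.
move=> [X0 FX0].
pose P (G : set (set T -> T)) :=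
  (forall g X, G g -> F X -> X (g X)) /\
  (forall g h X, G g -> G h -> F X -> g X = h X -> g = h).
have [C CP Ctot|G [[GF Ginj] Gmax]] := @Zorn_bigcup _ P.
  split=> [g X [G CG Gg] FX|g h X [G1 C1 Gg] [G2 C2 Gh] FX].
    exact: (CP _ CG).1 Gg FX.
  have [s12|s21] := Ctot _ _ C1 C2.
    exact: (CP _ C2).2 (s12 _ Gg) Gh FX.
  exact: (CP _ C1).2 Gg (s21 _ Gh) FX.
have [X FX surjX] : exists2 X, F X & forall x, X x -> exists2 g, G g & g X = x.
  apply: contrapT => nex.
  have ex X : exists x, F X -> X x /\ forall g, G g -> g X <> x.
    have [FX|nFX] := pselect (F X).
      apply: contrapT => nx; apply: nex; exists X => // x Xx.
      apply: contrapT => ng; apply: nx; exists x => _; split=> // g Gg gx.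
      by apply: ng; exists g.
    have [x _] : exists x, X0 x.
      apply: contrapT => nx; apply: nex; exists X0 => // x Xx.
      by case: nx; exists x.
    by exists x.
  have [h hP] := choice ex.
  have nGh : ~ G h by move=> Gh; exact: (hP X0 FX0).2 h Gh erefl.
  apply: (Gmax (G `|` [set h])).
    split; first by move=> g; left.
    by move=> /(_ h) sub; apply: nGh; apply: sub; right.
  split=> [g X [Gg|->] FX|g1 g2 X [G1|->] [G2|->] FX e //].
  - exact: (GF g X Gg FX).
  - exact: (hP _ FX).1.
  - exact: (Ginj g1 g2 X G1 G2 FX e).
  - by case: ((hP _ FX).2 _ G1).
  - by case: ((hP _ FX).2 _ G2).
exists X => // Y FY.
apply: (@card_le_trans _ _ _ G).
  apply: (card_le_trans _ (card_image_le (fun g => g X) G)).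
  by apply: subset_card_le => x Xx; have [g Gg <-] := surjX _ Xx; exists g.
apply: (@card_le_trans _ _ _ ((fun g => g Y) @` G)).
  have /card_eqPle[] // : (fun g => g Y) @` G #= G.
  by apply: inj_card_eq => g h /set_mem Gg /set_mem Gh; exact: (Ginj g h Y Gg Gh FY).
by apply: subset_card_le => _ [g Gg <-]; exact: (GF g Y Gg FY).
Qed.

Lemma min_cardP T (F : set (set T)) : F !=set0 ->
  F (min_card F) /\ forall Y, F Y -> min_card F #<= Y.
Proof.
move=> /min_card_ex [X FX Xmin].
by apply: (@xgetPex _ set0 [set X | F X /\ forall Y, F Y -> X #<= Y]); exists X.
Qed.

(* (L, R) is a cardinal in von Neumann's sense, i.e. an initial ordinal: a
   well-order (R is the non-strict order) whose proper initial segments all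
   have cardinality < |L|. Every cardinality is represented this way:
   see [initial_ordinal_ex] below. *)
Definition initial_ordinal (L : Type) (R : rel L) :=
  well_order R /\ forall x : L, [set y | ~~ R x y] #< [set: L].

(* |cofinality R| is the least cardinality of a cofinal subset of (L, R). *)
Definition cofinality (L : Type) (R : rel L) : set L :=
  min_card [set A : set L | forall x, exists2 a, A a & R x a].

(* |weak_power M K| is mu^{<kappa} = sup {mu^nu : nu < kappa}, i.e. the least
   cardinal that is an upper bound of these, where mu = |M|, kappa = |K| and
   mu^nu is the cardinality of the function type N -> M for |N| = nu. The
   type {N : set U & N -> M} is just large enough to contain such a set. *)
Definition weak_power T U (M : set T) (K : set U) : set {N : set U & N -> M} :=
  min_card [set S | forall N : set U, N #< K -> [set: N -> M] #<= S].

Arguments weak_power {T U} M K.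

Section BooleanAlgebra.
Local Open Scope order_scope.
Context {d : Order.disp_t} {B : ctbDistrLatticeType d}.
Implicit Types S X : set B.

Definition subalgebra S :=
  [/\ S \bot, S \top,
      forall x y, S x -> S y -> S (x `&` y) /\ S (x `|` y)
    & forall x, S x -> S (~` x)].

Definition positive S : set B := [set x | S x /\ x <> \bot].

(* |alg_density S| is the algebraic density pi(S) of a subalgebra S of B;
   pi(B) itself is the case S = [set: B]. *)
Definition alg_density S : set B :=
  min_card [set X | X `<=` positive S /\
                    forall y, positive S y -> exists2 x, X x & x <= y].

End BooleanAlgebra.

Section WellDefined.

Lemma initial_ordinal_ex (L : Type) : exists R : rel L, initial_ordinal R.
Proof.
elim/Peq: L => L; have [R wR] := well_ordering_principle L.
have [ini|/existsNP[x1 nx1]] := pselect (forall x, [set y | ~~ R x y] #< [set: L]).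
  by exists R.
pose F : {pred L} := fun x => [set: L] #<= [set y | ~~ R x y].
have [|x0 [[Fx0 minx0] _]] := wR F.
  exists x1; apply: contrapT => nF; apply: nx1; split=> //; exact: card_leT.
have /card_leP[f0] : [set: L] #<= [set y | ~~ R x0 y] by [].
pose f (y : L) : L := val (f0 (SigSub (in_setT y))).
have fx0 y : ~~ R x0 (f y) by have /set_mem := valP (f0 (SigSub (in_setT y))).
have finj : injective f.
  move=> y z /val_inj /(@inj _ _ setT f0) e.
  by have /(congr1 val) : SigSub (in_setT y) = SigSub (in_setT z)
    by apply: e; rewrite inE.
exists (fun y z => R (f y) (f z)); split.
  move=> A [a Aa]; pose fA : {pred L} := fun z => `[< exists2 y, y \in A & z = f y >].
  have [|z [[/asboolP[y Ay zy] zmin] zuniq]] := wR fA.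
    by exists (f a); apply/asboolP; exists a.
  exists y; split.
    split=> // w Aw; rewrite -zy; apply: zmin; apply/asboolP; by exists w.
  move=> w [Aw wmin]; apply: finj; rewrite -zy; apply: zuniq; split.
    by apply/asboolP; exists w.
  by move=> _ /asboolP[v Av ->]; apply: wmin.
move=> x; split; first exact: card_leT.
move=> le; have /negP := fx0 x; apply; apply: minx0.
apply: (card_le_trans le).
have /card_eqPle[_ le2] : f @` [set y | ~~ R (f x) (f y)] #= [set y | ~~ R (f x) (f y)].
  by apply: inj_card_eq => y z _ _; exact: finj.
by apply: (card_le_trans le2); apply: subset_card_le => _ [y /= ? <-].
Qed.

Lemma cofinalityP (L : Type) (R : rel L) : well_order R ->
  (forall x, exists2 a, cofinality R a & R x a) /\
  forall A : set L, (forall x, exists2 a, A a & R x a) -> cofinality R #<= A.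
Proof.
move=> wR; apply: (min_cardP (F := [set A | _])); exists setT => x; exists x => //.
have [|y [[/asboolP -> ub] _]] := wR (fun y => `[< y = x >]).
  by exists x; apply/asboolP.
by apply: ub; apply/asboolP.
Qed.

Lemma card_le_total T U (A : set T) (C : set U) : A #<= C \/ C #<= A.
Proof.
pose f := @inl T U; pose g := @inr T U.
have /card_eqPle[fA Af] : f @` A #= A by apply: inj_card_eq => x y _ _ [].
have /card_eqPle[gC Cg] : g @` C #= C by apply: inj_card_eq => x y _ _ [].
have [|X [->|->] Xmin] := @min_card_ex _ [set f @` A; g @` C].
- by exists (f @` A); left.
- by left; apply/(card_le_trans Af)/(card_le_trans _ gC)/Xmin; right.
- by right; apply/(card_le_trans Cg)/(card_le_trans _ fA)/Xmin; left.
Qed.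

Lemma weak_powerP T U (M : set T) (K : set U) :
  (forall N : set U, N #< K -> [set: N -> M] #<= weak_power M K) /\
  forall V (S : set V), (forall N : set U, N #< K -> [set: N -> M] #<= S) ->
    weak_power M K #<= S.
Proof.
have [|ub lub] := min_cardP (F := [set S : set {N : set U & N -> M} |
    forall N : set U, N #< K -> [set: N -> M] #<= S]).
  exists setT => N _; pose i := existT (fun N : set U => N -> M) N.
  have /card_eqPle[_ le] : i @` setT #= [set: N -> M].
    by apply: inj_card_eq => f g _ _; exact: existT_inj2.
  exact: card_le_trans le (card_leT _).
split=> // V S Sub.
have [le|le] := card_le_total [set: {N : set U & N -> M}] S.
  exact: card_le_trans (card_leT _) le.
have /card_subP[C CS _] := le.
have /card_eqPle[leCS leSC] := CS.
apply: (card_le_trans _ leCS); apply: lub => N NK.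
exact: card_le_trans (Sub N NK) leSC.
Qed.

Lemma alg_densityP d (B : ctbDistrLatticeType d) (S : set B) :
  [/\ alg_density S `<=` positive S,
      forall y, positive S y -> exists2 x, alg_density S x & (x <= y)%O
    & forall X, X `<=` positive S ->
        (forall y, positive S y -> exists2 x, X x & (x <= y)%O) ->
        alg_density S #<= X].
Proof.
have [|[s1 s2] h] := min_cardP (F := [set X | X `<=` positive S /\
                    forall y, positive S y -> exists2 x, X x & (x <= y)%O]).
  by exists (positive S); split=> // y Sy; exists y.
by split=> // X X1 X2; apply: h.
Qed.

End WellDefined.

(* Main.v *)
(* Write T for a cofinal subset of lambda of size cf(lambda), and pi(c) for the
   density of B below c.  If lambda is regular, choose b_i (i < lambda) such that
   no positive element generated by the b_j with j < i lies below b_i; a set that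
   is dense in the generated algebra is then unbounded in the chain.

   Let lambda be singular.  An antichain of size lambda suffices, and so does a
   family of c whose densities pi(c) <= lambda are unbounded in lambda (take dense
   sets below these c), or an antichain of size cf(lambda) of elements with
   pi(c) > lambda (put below each of them a chain of regular length).  If none of
   these is available, there is c such that pi(c') > lambda for all positive
   c' <= c, and all antichains below c are smaller than cf(lambda).  In case (A)
   this is absurd.

   Otherwise let N be a subalgebra closed under suprema and disjoint witnesses of
   sets smaller than cf(lambda), and let a <= c be outside N.  The elements of N
   below a or below c - a do not exhaust c, so a splits every positive element of
   N below some p in N.  Closing off yields, for every K with |K|^{<cf(lambda)} =
   |K| < |{x : x <= c}|, an element p such that every algebra of size |K| is split
   below p in this way.  Adding such splitting elements lambda times, below
   elements p fixed in advance, gives an algebra in which each positive element is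
   below only finitely many of them, so its density is lambda.  In case (B) the p
   are cf(lambda) many; in case (C) either lambda is a strong limit, or 2^mu >=
   lambda for some mu < lambda and a single p works for K = 2^mu. *)
Require Import Defs.
From mathcomp Require Import all_boot all_order.
From mathcomp Require Import boolp wochoice classical_sets functions cardinality.
Local Open Scope classical_set_scope.
Local Open Scope card_scope.
Import Order.Theory.

Set Implicit Arguments.
Unset Strict Implicit.
Unset Printing Implicit Defensive.

(** * Cardinal arithmetic *)

Lemma choice_on T U (A : set T) (u0 : U) (P : T -> U -> Prop) :
  (forall x, A x -> exists y, P x y) ->
  exists f : T -> U, forall x, A x -> P x (f x).
Proof.
move=> ex; have [x|f fP] := choice (P := fun x y => A x -> P x y); last by exists f.
have [Ax|nAx] := pselect (A x); last by exists u0.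
by have [y Py] := ex _ Ax; exists y.
Qed.

Lemma card_le_inj T U (A : set T) (C : set U) (f : T -> U) :
  (forall a, A a -> C (f a)) ->
  (forall a a', A a -> A a' -> f a = f a' -> a = a') -> A #<= C.
Proof.
move=> fC finj; have /card_eqPle[_ le] : f @` A #= A.
  by apply: inj_card_eq => x y /set_mem Ax /set_mem Ay; exact: finj.
by apply: (card_le_trans le); apply: subset_card_le => _ [a Aa <-]; exact: fC.
Qed.

Lemma card_leRP T U (A : set T) (C : set U) :
  A #<= C <-> exists r : T -> U -> Prop,
    (forall a, A a -> exists2 c, C c & r a c) /\
    (forall a a' c, A a -> A a' -> r a c -> r a' c -> a = a').
Proof.
split=> [/card_leP[f]|[r [rtot rinj]]].
  exists (fun a c => exists2 a' : A, val a' = a & c = val (f a')); split.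
    move=> a Aa; exists (val (f (SigSub (mem_set Aa)))).
      exact: (set_mem (valP _)).
    by exists (SigSub (mem_set Aa)).
  move=> _ _ _ _ _ [a <- ->] [a' <- /val_inj e].
  by rewrite (@inj _ _ setT f a a') ?inE.
(* Choosing in [option U] supplies the default value [None], since [U] may be empty. *)
have [f fP] := choice_on None (fun a Aa => let: ex_intro2 c Cc rc := rtot a Aa in
  ex_intro (fun o => exists2 c, C c & r a c /\ o = Some c) (Some c)
    (ex_intro2 _ _ c Cc (conj rc erefl))).
apply: (@card_le_trans _ _ _ (Some @` C)).
  apply: (card_le_inj (f := f)) => [a Aa|a a' Aa Aa' e].
    by have [c Cc [_ ->]] := fP _ Aa; exists c.
  have [c Cc [rc ec]] := fP _ Aa; have [c' _ [rc' ec']] := fP _ Aa'.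
  move: e rc'; rewrite ec ec' => -[<-]; exact: rinj.
by have /card_eqPle[] := @card_some _ C.
Qed.

Lemma card_le_rel T U (A : set T) (C : set U) (r : T -> U -> Prop) :
    (forall a, A a -> exists2 c, C c & r a c) ->
    (forall a a' c, A a -> A a' -> r a c -> r a' c -> a = a') ->
  A #<= C.
Proof. by move=> ? ?; apply/card_leRP; exists r. Qed.

Lemma card_le_inj_ex T U (A : set T) (C : set U) (u0 : U) : A #<= C ->
  exists2 f : T -> U, (forall a, A a -> C (f a)) &
    (forall a a', A a -> A a' -> f a = f a' -> a = a').
Proof.
move=> /card_leRP[r [rtot rinj]].
have [f fP] : exists f : T -> U, forall a, A a -> C (f a) /\ r a (f a).
  by apply: (choice_on (P := fun a y => C y /\ r a y) u0) => a /rtot[c]; exists c.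
exists f => [a /fP[]//|a a' Aa Aa' e].
apply: (rinj _ _ (f a)) => //; first exact: (fP _ Aa).2.
by rewrite e; exact: (fP _ Aa').2.
Qed.

Lemma card_le_surj_ex T U (A : set T) (C : set U) (t0 : T) : A t0 -> A #<= C ->
  exists2 g : U -> T, (forall u, A (g u)) &
    (forall a, A a -> exists2 u, C u & g u = a).
Proof.
move=> At0 /card_leRP[r [rtot rinj]].
have [g gP] : exists g : U -> T, forall u, setT u ->
    A (g u) /\ ((exists2 a, A a & r a u) -> r (g u) u).
  apply: (choice_on (A := setT) (P := fun u t =>
    A t /\ ((exists2 a, A a & r a u) -> r t u)) t0) => u _.
  have [[a Aa ra]|nex] := pselect (exists2 a, A a & r a u); first by exists a.
  by exists t0.
exists g => [u|a Aa]; first by have [] := gP u I.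
have [u Cu ru] := rtot _ Aa; exists u => //.
have [Ag rg] := gP u I; apply: (rinj _ _ u) => //; apply: rg; by exists a.
Qed.

Lemma not_card_le_lt T U (A : set T) (C : set U) : ~ (C #<= A) -> A #< C.
Proof. by move=> nle; split=> //; have [] := card_le_total A C. Qed.

Lemma card_le_lt_trans T U V (A : set T) (C : set U) (E : set V) :
  A #<= C -> C #< E -> A #< E.
Proof.
move=> leAC [CD nDC]; split; first exact: card_le_trans leAC CD.
by move=> DA; apply: nDC; apply: card_le_trans DA leAC.
Qed.

Lemma card_lt_le_trans T U V (A : set T) (C : set U) (E : set V) :
  A #< C -> C #<= E -> A #< E.
Proof.
move=> [leAC nCA] CD; split; first exact: card_le_trans leAC CD.
by move=> DA; apply: nCA; apply: card_le_trans CD DA.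
Qed.

Lemma infinite_card_le T U (A : set T) (C : set U) :
  infinite_set A -> A #<= C -> infinite_set C.
Proof. by move=> /infiniteP NA leAC; apply/infiniteP; exact: card_le_trans NA leAC. Qed.

Lemma finite_card_lt T U (A : set T) (C : set U) :
  finite_set A -> infinite_set C -> A #< C.
Proof. by move=> fA iC; apply: not_card_le_lt => /card_le_finite /(_ fA). Qed.

Lemma card_leX2 T U T' U' (A : set T) (C : set U) (A' : set T') (C' : set U') :
  A #<= C -> A' #<= C' -> A `*` A' #<= C `*` C'.
Proof.
move=> /card_leRP[r [rtot rinj]] /card_leRP[r' [rtot' rinj']].
apply: (card_le_rel (r := fun p q => r p.1 q.1 /\ r' p.2 q.2)).
  move=> [a a'] [/= /rtot[c Cc rc] /rtot'[c' Cc' rc']]; by exists (c, c').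
move=> [a a'] [b b'] [c c'] [/= Aa Aa'] [/= Ab Ab'] [/= r1 r1'] [r2 r2'].
by rewrite (rinj a b c) // (rinj' a' b' c').
Qed.

(** Two distinct elements [k] and [k'] of [K] tag disjoint copies of [K] inside its square. *)
Lemma card_leU_X T U (A A' : set T) (K : set U) :
  infinite_set K -> A #<= K -> A' #<= K -> A `|` A' #<= K `*` K.
Proof.
move=> Kinf /card_leRP[r [rtot rinj]] /card_leRP[r' [rtot' rinj']].
have [k Kk] := infinite_setN0 Kinf.
have [k' [Kk' kk']] : exists k', K k' /\ k <> k'.
  apply: contrapT => nex; apply: Kinf; apply: (sub_finite_set (B := [set k])) => //.
  by move=> z Kz; apply: contrapT => zk; apply: nex; exists z; split=> // /esym.
apply: (card_le_rel (r := fun a q => (A a /\ r a q.1 /\ q.2 = k) \/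
   (A' a /\ r' a q.1 /\ q.2 = k'))).
  move=> a [/[dup] Aa /rtot[c Kc rc]|/[dup] Aa /rtot'[c Kc rc]].
    by exists (c, k); last left.
  by exists (c, k'); last right.
move=> a a' [c q] _ _ [[Aa [ra ->]]|[Aa [ra ->]]] [[Aa' [ra' //= e]]|[Aa' [ra' //= e]]].
- exact: (rinj _ _ c).
- by case: kk'.
- exact: (rinj' _ _ c).
Qed.

(** Zorn's lemma for graphs [G] relating the pairs from [X G] injectively to elements of [X G], a
    subset of [K]. A nonempty [G] must have [X G] infinite, so that the extension step can compute
    with |X G|. *)
Lemma card_le_square T (K : set T) : infinite_set K -> K `*` K #<= K.
Proof.
move=> Kinf.
pose X (G : set ((T * T) * T)) := [set x | exists z, G ((x, x), z)].
pose P (G : set ((T * T) * T)) := [/\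
  forall x y z, G ((x, y), z) -> [/\ K z, X G x, X G y & X G z],
  X G `<=` K,
  forall x y, X G x -> X G y -> exists z, G ((x, y), z),
  forall p q z, G (p, z) -> G (q, z) -> p = q
  & G = set0 \/ infinite_set (X G)].
have Xmono G G' : G `<=` G' -> X G `<=` X G' by move=> s x [z Gz]; exists z; exact: s.
have [F FP Ftot|G [[G1 G2 G3 G4 G5] Gmax]] := @Zorn_bigcup _ P.
  split.
  - move=> x y z [G FG Gz]; have [+ _ _ _ _] := FP _ FG.
    move=> /(_ _ _ _ Gz)[Kz Xx Xy Xz].
    by split=> //; apply: (Xmono G) => //; exact: bigcup_sup.
  - by move=> x [z [G FG Gz]]; have [_ + _ _ _] := FP _ FG; apply; exists z.
  - move=> x y [z [G FG Gz]] [z' [G' FG' Gz']].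
    have [s|s] := Ftot _ _ FG FG'.
      have [_ _ + _ _] := FP _ FG'; case/(_ x y).
      + by exists z; exact: s.
      + by exists z'.
      + by move=> w Gw; exists w; exists G'.
    have [_ _ + _ _] := FP _ FG; case/(_ x y).
    + by exists z.
    + by exists z'; exact: s.
    + by move=> w Gw; exists w; exists G.
  - move=> p q z [G FG Gz] [G' FG' Gz'].
    have [s|s] := Ftot _ _ FG FG'.
      by have [_ _ _ + _] := FP _ FG'; apply; [exact: s Gz|].
    by have [_ _ _ + _] := FP _ FG; apply; [exact: Gz|exact: s].
  - have [[G FG Ginf]|nex] := pselect (exists2 G, F G & infinite_set (X G)).
      right; apply: (infinite_card_le Ginf); apply: subset_card_le.
      by apply: Xmono; exact: bigcup_sup.
    left; apply/seteqP; split=> // p [G FG Gp].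
    have [_ _ _ _ [G0|Ginf]] := FP _ FG; first by rewrite G0 in Gp.
    by case: nex; exists G.
(* A countable part of [K] with the pairing [pickle] is a nonempty candidate, so the maximal [G] is
   not empty. *)
have Xinf : infinite_set (X G).
  case: G5 => // G0.
  exfalso; have [k0 _] := infinite_setN0 Kinf.
  have /infiniteP /(card_le_inj_ex k0)[f fK finj] := Kinf.
  pose H : set ((T * T) * T) :=
    [set w | exists m n, w = ((f m, f n), f (pickle (m, n)))].
  have XH n : X H (f n) by exists (f (pickle (n, n))), n, n.
  apply: (Gmax H).
    rewrite G0; split=> // /(_ ((f 0, f 0), f (pickle (0, 0)))); apply.
    by exists 0, 0.
  split.
  - by move=> _ _ _ [m [n [-> -> ->]]]; split=> //; exact: fK.
  - by move=> _ [_ [m [n [-> _ _]]]]; exact: fK.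
  - move=> _ _ [_ [m [_ [-> _ _]]]] [_ [n [_ [-> _ _]]]].
    by exists (f (pickle (m, n))), m, n.
  - move=> _ _ _ [m [n [-> ->]]] [m' [n' [-> /finj e]]].
    by have [-> ->] := pcan_inj pickleK (e I I).
  - right; apply/infiniteP; apply: (card_le_inj (f := f)) => [n _|a a' _ _].
      exact: XH.
    exact: finj.
have XX : X G `*` X G #<= X G.
  apply: (card_le_rel (r := fun p z => G (p, z))) => [[x y] [/= Xx Xy]|p q z _ _].
    by have [z Gz] := G3 _ _ Xx Xy; exists z => //; have [] := G1 _ _ _ Gz.
  exact: G4.
have le2 (Y : set T) : Y #<= X G -> X G `|` Y #<= X G.
  by move=> YX; apply: (card_le_trans _ XX); exact: card_leU_X.
(* If the rest of [K] is no larger than [X G], then |K| = |X G|. Otherwise it contains a copy [Y] of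
   [X G], and [G] extends to the union of [X G] and [Y] by sending the new pairs into [Y]. *)
have [le|le] := card_le_total (K `\` X G) (X G).
  have KX : K #<= X G.
    apply: (card_le_trans _ (le2 _ le)); apply: subset_card_le => x Kx.
    by have [?|?] := pselect (X G x); [left|right].
  apply: (card_le_trans (card_leX2 KX KX)); apply: (card_le_trans XX).
  exact: subset_card_le.
exfalso; have /card_subP[Y /card_eqPle[YX XY] YK] := le.
pose Z := X G `|` Y; have ZX : Z #<= X G by exact: le2.
have /card_leRP[r [rtot rinj]] : (Z `*` Z) `\` (X G `*` X G) #<= Y.
  apply: (card_le_trans (card_le_setD _ _)); apply: (card_le_trans (card_leX2 ZX ZX)).
  exact: (card_le_trans XX XY).
pose H := G `|` [set w | [/\ (Z `*` Z) w.1, ~ (X G `*` X G) w.1, Y w.2 & r w.1 w.2]].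
have XHZ : X H = Z.
  apply/seteqP; split=> x.
    move=> [z [Gz|[[Zx _] _ _ _]]] //; left; by exists z.
  have [[z Gz] _|nXx Zx] := pselect (X G x); first by exists z; left.
  have [|z Yz rz] := rtot (x, x); first by split=> // -[].
  by exists z; right; split=> // -[].
have [y Yy] : Y !=set0 by apply: infinite_setN0; exact: infinite_card_le XY.
have YnX z : Y z -> ~ X G z by move=> /YK[].
apply: (Gmax H).
  split; first by move=> w; left.
  move=> sHG; have : X H y by rewrite XHZ; right.
  by move=> /(Xmono _ _ sHG); exact: YnX.
have GY p z : G (p, z) -> ~ Y z.
  by case: p => a b /G1[_ _ _ Xz] Yz; exact: YnX Yz Xz.
split; rewrite ?XHZ.
- move=> a b z [/G1[Kz Xa Xb Xz]|[[/= Za Zb] _ Yz _]].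
    by split=> //; left.
  by split=> //; [have [] := YK _ Yz|right].
- by move=> z [/G2//|/YK[]].
- move=> a b Za Zb; have [[Xa Xb]|nX] := pselect ((X G `*` X G) (a, b)).
    by have [z Gz] := G3 _ _ Xa Xb; exists z; left.
  by have [//|z Yz rz] := rtot (a, b); exists z; right.
- move=> p q z [Gp|[/= Zp nXp Yz rp]] [Gq|[/= Zq nXq Yz' rq]].
  + exact: G4 Gp Gq.
  + by case: (GY _ _ Gp).
  + by case: (GY _ _ Gq).
  + by apply: (rinj p q z).
- right; apply: (infinite_card_le Xinf); apply: subset_card_le; exact: subsetUl.
Qed.

Lemma card_leX_inf T T' U (A : set T) (A' : set T') (K : set U) :
  infinite_set K -> A #<= K -> A' #<= K -> A `*` A' #<= K.
Proof.
move=> Kinf AK AK'; apply: (card_le_trans (card_leX2 AK AK')).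
exact: card_le_square.
Qed.

Lemma card_leU_inf T U (A A' : set T) (K : set U) :
  infinite_set K -> A #<= K -> A' #<= K -> A `|` A' #<= K.
Proof.
move=> Kinf AK AK'; apply: (card_le_trans (card_leU_X Kinf AK AK')).
exact: card_le_square.
Qed.

Lemma card_le_bigcup T I U (D : set I) (F : I -> set T) (K : set U) :
  infinite_set K -> D #<= K -> (forall i, D i -> F i #<= K) ->
  \bigcup_(i in D) F i #<= K.
Proof.
move=> Kinf DK FK; have [k0 _] := infinite_setN0 Kinf.
apply: (@card_le_trans _ _ _ (D `*` K)); last exact: card_leX_inf.
have [f fP] := choice_on (fun _ : T => k0)
   (fun i Di => let: ex_intro2 f fK finj := card_le_inj_ex k0 (FK i Di) in
    ex_intro (fun f => (forall a, F i a -> K (f a)) /\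
      (forall a a', F i a -> F i a' -> f a = f a' -> a = a')) f (conj fK finj)).
apply: (card_le_rel (r := fun t p => [/\ D p.1, F p.1 t & p.2 = f p.1 t])).
  move=> t [i Di Fit]; exists (i, f i t) => //; split=> //=.
  exact: (fP _ Di).1.
by move=> t t' [i k] _ _ [/= Di Ft ->] [_ Ft' /(fP _ Di).2]; apply.
Qed.

Lemma card_lt_setU T U (A A' : set T) (K : set U) :
  infinite_set K -> A #< K -> A' #< K -> A `|` A' #< K.
Proof.
move=> Kinf; wlog le : A A' / A #<= A'.
  move=> h AK AK'; have [le|le] := card_le_total A A'; first exact: h.
  by rewrite setUC; exact: h.
move=> AK AK'; have [finA'|infA'] := pselect (finite_set A').
  apply: finite_card_lt => //; rewrite finite_setU; split=> //.
  exact: card_le_finite le finA'.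
by apply: (card_le_lt_trans _ AK'); exact: card_leU_inf.
Qed.

Lemma card_lt_common U V W (T : set U) (X : set V) (K : set W) :
  infinite_set T -> T #< K -> X #< K ->
  exists M : set W, [/\ infinite_set M, T #<= M, X #<= M & M #< K].
Proof.
move=> Tinf TK XK; have [XT|TX] := card_le_total X T.
  have /card_subP[M /card_eqPle[MT TM] _] := TK.1.
  exists M; split=> //; last exact: card_le_lt_trans TK.
  - exact: infinite_card_le TM.
  - exact: card_le_trans XT TM.
have /card_subP[M /card_eqPle[MX XM] _] := XK.1.
exists M; split=> //; last exact: card_le_lt_trans XK.
- exact: infinite_card_le Tinf (card_le_trans TX XM).
- exact: card_le_trans TX XM.
Qed.

Lemma image_inj_on U V (f : U -> V) (A s t : set U) :
  (forall a a', A a -> A a' -> f a = f a' -> a = a') ->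
  s `<=` A -> t `<=` A -> f @` s = f @` t -> s = t.
Proof.
move=> finj; have sub (r r' : set U) : r `<=` A -> r' `<=` A ->
    f @` r `<=` f @` r' -> r `<=` r'.
  move=> rA rA' rr x rx; have [|y ry /finj e] := rr (f x); first by exists x.
  by rewrite -e //; [exact: rA'|exact: rA].
by move=> sA tA e; apply/seteqP; split; apply: sub => //; rewrite e.
Qed.

Definition subsets_of U (M : set U) : set (set U) := [set s | s `<=` M].

Lemma card_le_subsets_of U V (A : set U) (K : set V) :
  K !=set0 -> A #<= K -> subsets_of A #<= subsets_of K.
Proof.
move=> [k0 _] /(card_le_inj_ex k0)[f fK finj].
apply: (card_le_inj (f := fun s => f @` s)) => [s sA _ [x /sA /fK ? <-]//|s t sA tA].
exact: image_inj_on sA tA.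
Qed.

Lemma card_le_subsets_bool U (M : set U) : subsets_of M #<= [set: M -> bool].
Proof.
apply: (card_le_inj (f := fun s (m : M) => `[< s (val m) >])) => // s s' sM sM' e.
have sub m : M m -> `[< s m >] = `[< s' m >].
  by move=> Mm; have := congr1 (@^~ (SigSub (mem_set Mm))) e.
apply/seteqP; split=> m sm; apply/asboolP.
  by rewrite -sub; [exact/asboolP|exact: sM].
by rewrite sub; [exact/asboolP|exact: sM'].
Qed.

Definition small_subsets U V (T : set V) (K : set U) : set (set U) :=
  [set s | s `<=` K /\ s #< T].

Lemma card_le_small_subsets U U' V (T : set V) (A : set U) (K : set U') :
  K !=set0 -> A #<= K -> small_subsets T A #<= small_subsets T K.
Proof.
move=> [k0 _] /(card_le_inj_ex k0)[f fK finj].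
apply: (card_le_inj (f := fun s => f @` s)) => [s [sA sT]|s t [sA _] [tA _]].
  split; first by move=> _ [x /sA /fK ? <-].
  exact: card_le_lt_trans (card_image_le _ _) sT.
exact: image_inj_on sA tA.
Qed.

(** * Well-orders and generated subalgebras *)

Section WellOrder.
Variables (L : Type) (R : rel L).
Hypothesis wR : well_order R.

Definition segment (x : L) : set L := [set y | ~~ R x y].

Lemma wo_min (A : set L) : A !=set0 -> exists2 z, A z & forall x, A x -> R z x.
Proof.
move=> [a Aa]; have [|z [[Az zmin] _]] := wR (A := fun x => `[< A x >]).
  by exists a; apply/asboolP.
by exists z => [|x Ax]; [exact/asboolP|apply: zmin; exact/asboolP].
Qed.

Lemma wo_refl x : R x x.
Proof. by have [|z -> /(_ x)] := @wo_min [set x]; [exists x|apply]. Qed.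

Lemma wo_total x y : R x y \/ R y x.
Proof.
have [|z [->|->] zmin] := @wo_min [set x; y]; first by exists x; left.
- by left; apply: zmin; right.
- by right; apply: zmin; left.
Qed.

Lemma wo_anti x y : R x y -> R y x -> x = y.
Proof.
move=> xy yx; have [|z [_ zuniq]] := wR (A := fun w => `[< w = x \/ w = y >]).
  by exists x; apply/asboolP; left.
rewrite -(zuniq x) ?(zuniq y) //; (split; first by apply/asboolP; auto);
  by move=> w /asboolP[->|->] //; exact: wo_refl.
Qed.

Lemma wo_trans x y z : R x y -> R y z -> R x z.
Proof.
move=> xy yz.
have [|w [->|[->|->]] wmin] := @wo_min [set w | w = x \/ w = y \/ w = z].
- by exists x; left.
- by apply: wmin; right; right.
- have yx : R y x by apply: wmin; left.
  by rewrite (wo_anti xy yx).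
- have zy : R z y by apply: wmin; right; left.
  by rewrite -(wo_anti yz zy).
Qed.

Lemma segmentN x y : ~ segment x y <-> R x y.
Proof. by rewrite /segment /=; split=> [/negP|->//]; rewrite negbK. Qed.

Lemma not_segment x y : ~ segment x y -> R x y.
Proof. by move=> /segmentN. Qed.

Lemma segment_leW x y : segment x y -> R y x.
Proof. by move=> /negP nxy; have [|] := wo_total x y. Qed.

Lemma segment_lt_le x y z : segment y x -> R y z -> segment z x.
Proof. by move=> /negP nyx yz; apply/negP => zx; apply: nyx; exact: wo_trans yz zx. Qed.

Lemma segment_le_lt x y z : R x y -> segment z y -> segment z x.
Proof. by move=> xy /negP nzy; apply/negP => zx; apply: nzy; exact: wo_trans zx xy. Qed.

Lemma segment_irr x : ~ segment x x.
Proof. by rewrite segmentN; exact: wo_refl. Qed.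

Lemma segmentVeq x y : R x y -> segment y x \/ x = y.
Proof.
move=> xy; have [yx|nyx] := pselect (R y x); last by left; apply/negP.
by right; exact: wo_anti.
Qed.

Lemma wo_ind (P : L -> Prop) :
  (forall x, (forall y, segment x y -> P y) -> P x) -> forall x, P x.
Proof.
move=> IH x; apply: contrapT => nPx.
have [|z nPz zmin] := @wo_min [set x | ~ P x]; first by exists x.
apply: nPz; apply: IH => y yz; apply: contrapT => /zmin.
by apply/negP.
Qed.

Lemma wo_wf : well_founded (fun y x => segment x y).
Proof. by move=> x; elim/wo_ind: x => x IH; constructor. Qed.

(** Recursion with a choice at each step: [Q x f] depends on [f] only before [x], so the later,
    unknown values can be filled in with [u0]. *)
Lemma wo_rec_ex U (u0 : U) (Q : L -> (L -> U) -> U -> Prop) :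
  (forall x f, exists u, Q x f u) ->
  (forall x f g u, (forall y, segment x y -> f y = g y) -> Q x f u -> Q x g u) ->
  exists f, forall x, Q x f (f x).
Proof.
move=> Qex Qloc.
have [h hP] : exists h : L * (L -> U) -> U, forall p, setT p -> Q p.1 p.2 (h p).
  by apply: (choice_on (P := fun p u => Q p.1 p.2 u) u0) => p _; exact: Qex.
pose ext x (rec : forall y, segment x y -> U) y :=
  if pselect (segment x y) is left yx then rec y yx else u0.
pose F x rec := h (x, ext x rec).
pose f := Fix wo_wf (fun=> U) F.
have fE x : f x = h (x, ext x (fun y _ => f y)).
  rewrite /f Fix_eq // => {}x r1 r2 r12; congr (h (x, _)).
  by apply: funext => y; rewrite /ext; case: pselect.
exists f => x; rewrite fE; have /= := hP (x, ext x (fun y _ => f y)) I.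
apply: Qloc => y xy.
by rewrite /ext; case: pselect.
Qed.

End WellOrder.

Section BA.
Context {d : Order.disp_t} {B : ctbDistrLatticeType d}.
Implicit Types (x y z a c : B) (S X Q : set B).

Lemma disjP x y : (x `&` y = \bot)%O <-> (x <= ~` y)%O.
Proof. by rewrite -disj_leC; split=> [->|/eqP]. Qed.

Lemma le_disjP x y : (x <= y)%O <-> (x `&` ~` y = \bot)%O.
Proof. by rewrite disjP complK. Qed.

Lemma le_bot x y : (x <= y)%O -> y = \bot%O -> x = \bot%O.
Proof. by move=> xy y0; apply/eqP; rewrite -lex0 -y0. Qed.

Lemma disj_le2 x y x' y' : (x' <= x)%O -> (y' <= y)%O ->
  (x `&` y = \bot)%O -> (x' `&` y' = \bot)%O.
Proof. by move=> xx yy; apply: le_bot; exact: leI2. Qed.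

Lemma meet_compl_congr x y c :
  (x `&` c = y `&` c)%O -> (~` x `&` c = ~` y `&` c)%O.
Proof.
move=> e; apply: le_anti; rewrite !lexI !leIr !andbT.
apply/andP; split; apply/disjP.
  by rewrite -meetA [(c `&` _)%O]meetC -e meetA meetCx meet0x.
by rewrite -meetA [(c `&` _)%O]meetC e meetA meetCx meet0x.
Qed.

Inductive gen S : B -> Prop :=
| gen_sub x : S x -> gen S x
| gen_bot : gen S \bot%O
| gen_meet x y : gen S x -> gen S y -> gen S (x `&` y)%O
| gen_compl x : gen S x -> gen S (~` x)%O.

Lemma gen_join S x y : gen S x -> gen S y -> gen S (x `|` y)%O.
Proof.
move=> Sx Sy; rewrite -[(x `|` y)%O]complK complU.
by apply/gen_compl/gen_meet; exact: gen_compl.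
Qed.

Lemma gen_subalgebra S : subalgebra (gen S : set B).
Proof.
split=> [||x y Sx Sy|x]; first exact: gen_bot.
- by rewrite -compl0; apply/gen_compl/gen_bot.
- by split; [exact: gen_meet|exact: gen_join].
- exact: gen_compl.
Qed.

Lemma gen_min S X : subalgebra X -> S `<=` X -> gen S `<=` X.
Proof.
move=> [X0 _ Xm Xc] SX x; elim=> {x} //.
- by move=> y z _ Xy _ Xz; have [] := Xm y z Xy Xz.
- by move=> y _; exact: Xc.
Qed.

Lemma gen_mono S X : S `<=` X -> gen S `<=` gen X.
Proof.
by move=> SX; apply: gen_min (gen_subalgebra X) _ => x /SX; exact: gen_sub.
Qed.

Lemma card_gen U (S : set B) (K : set U) :
  infinite_set K -> S #<= K -> (gen S : set B) #<= K.
Proof.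
move=> Kinf SK.
have fK V (A : set V) : finite_set A -> A #<= K by move=> /finite_card_lt /(_ Kinf)[].
pose G := fix G n : set B := if n is m.+1 then
   G m `|` ((fun p => p.1 `&` p.2)%O @` (G m `*` G m) `|` Order.compl @` G m)
  else S `|` [set \bot%O].
have GK n : G n #<= K.
  elim: n => [|n IH] /=; first by apply: card_leU_inf => //; exact: fK.
  apply: card_leU_inf => //; apply: card_leU_inf => //.
    by apply: (card_le_trans (card_image_le _ _)); exact: card_leX_inf.
  exact: (card_le_trans (card_image_le _ _)).
apply: (@card_le_trans _ _ _ (\bigcup_(n in setT) G n)); last first.
  by apply: card_le_bigcup => //; apply/infiniteP.
apply: subset_card_le; have GS m n : G m `<=` G (m + n).
  by elim: n => [|n IH]; rewrite ?addn0 // addnS => x /IH; left.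
move=> x; elim=> {x}.
- by move=> x Sx; exists 0 => //; left.
- by exists 0 => //; right.
- move=> x y _ [m _ Gx] _ [n _ Gy]; exists (m + n).+1 => //; right; left.
  exists (x, y) => //; split=> /=; first exact: GS.
  by rewrite addnC; exact: GS.
- by move=> x _ [n _ Gx]; exists n.+1 => //; right; right; exists x.
Qed.

(** An element involves finitely many generators, so among the indices from [D] that occur there is
    a largest one, unless none occurs. *)
Lemma gen_directed (L : Type) (R : rel L) (b : L -> B) Q (D : set L) :
  well_order R -> gen (Q `|` b @` D) `<=`
    [set x | gen Q x \/ exists2 g, D g & gen (Q `|` b @` [set y | D y /\ R y g]) x].
Proof.
move=> wR; set Y := [set x | _].
pose Z g := gen (Q `|` b @` [set y | D y /\ R y g]).
have ZQ g : gen Q `<=` Z g by apply: gen_mono => x; left.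
have Zle g g' : R g g' -> Z g `<=` Z g'.
  move=> gg'; apply: gen_mono => x [Qx|[y [Dy yg] <-]]; [by left|right].
  by exists y => //; split=> //; exact: wo_trans yg gg'.
have Zc x : Y x -> Y (~` x)%O.
  by move=> [Qx|[g Dg Zx]]; [left|right; exists g => //]; exact: gen_compl.
have Zm x y : Y x -> Y y -> Y (x `&` y)%O.
  move=> [Qx|[g Dg Zx]] [Qy|[h Dh Zy]]; first by left; exact: gen_meet.
  - by right; exists h => //; apply: gen_meet => //; exact: ZQ.
  - by right; exists g => //; apply: gen_meet => //; exact: ZQ.
  - have [le|le] := wo_total wR g h; right.
      by exists h => //; apply: gen_meet => //; exact: Zle Zx.
    by exists g => //; apply: gen_meet => //; exact: Zle Zy.
apply: gen_min; last first.
  move=> x [Qx|[g Dg <-]]; first by left; exact: gen_sub.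
  right; exists g => //; apply: gen_sub; right; exists g => //; split=> //.
  exact: wo_refl.
split=> //; first by left; exact: gen_bot.
- by left; rewrite -compl0; exact/gen_compl/gen_bot.
- move=> x y Yx Yy; split; first exact: Zm.
  by rewrite -[(x `|` y)%O]complK complU; apply/Zc/Zm; exact: Zc.
Qed.

Definition realizes_density (L : Type) := exists B' : set B,
  [/\ subalgebra B', alg_density B' #= [set: L] & B' #= [set: L]].

(** The density of an algebra is at most its size, here at most |L|; only the lower bound on dense
    sets is at stake. *)
Lemma realizes_densityI (L : Type) S : infinite_set [set: L] -> S #<= [set: L] ->
  (forall X, (forall y, gen S y -> y <> \bot%O ->
      exists2 x, X x & [/\ gen S x, x <> \bot%O & (x <= y)%O]) ->
    [set: L] #<= X) -> realizes_density L.
Proof.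
move=> Linf SL dense; exists (gen S).
have gL : (gen S : set B) #<= [set: L] by exact: card_gen.
have [s1 s2 _] := alg_densityP (gen S : set B).
have Ld : [set: L] #<= alg_density (gen S : set B).
  apply: dense => y Sy y0; have [//|x dx xy] := s2 y.
  by exists x => //; have [] := s1 _ dx.
have dg : alg_density (gen S : set B) #<= (gen S : set B).
  by apply: subset_card_le => x /s1[].
split; first exact: gen_subalgebra.
- by apply/card_eqPle; split=> //; exact: card_le_trans dg gL.
- by apply/card_eqPle; split=> //; exact: card_le_trans Ld dg.
Qed.

Definition antichain (A : set B) :=
  (forall x, A x -> x <> \bot%O) /\
  (forall x y, A x -> A y -> x <> y -> (x `&` y = \bot)%O).

(** Positive elements below distinct members of an antichain are disjoint, hence distinct. *)
Lemma realizes_density_antichain (L : Type) A : infinite_set [set: L] ->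
  antichain A -> [set: L] #<= A -> realizes_density L.
Proof.
move=> Linf [A0 Ad] /card_subP[S /card_eqPle[SL LS] SA].
apply: (realizes_densityI (S := S)) => // X Xd; apply: (card_le_trans LS).
apply: (card_le_rel (r := fun a x => x <> \bot%O /\ (x <= a)%O)).
  move=> a Sa; have [||x Xx [_ x0 xa]] := Xd a; first exact: gen_sub.
    by apply: A0; exact: SA.
  by exists x.
move=> a a' x Sa Sa' [x0 xa] [_ xa']; apply: contrapT => aa'.
by apply: x0; apply: le_bot (Ad _ _ (SA _ Sa) (SA _ Sa') aa'); rewrite lexI xa.
Qed.

Definition dense_below c X :=
  forall y, y <> \bot%O -> (y <= c)%O -> exists2 x, X x & x <> \bot%O /\ (x <= y)%O.

(** The density of [B] below [c] is at most |K|. The set [X] may also contain zero or elements not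
    below [c]. *)
Definition density_le U c (K : set U) := exists2 X, dense_below c X & X #<= K.

Lemma density_le_top U (K : set U) : K #< alg_density [set: B] ->
  ~ density_le \top%O K.
Proof.
move=> [_ nle] [X Xd XK]; apply: nle; have [_ _ dmin] := alg_densityP [set: B].
apply: (@card_le_trans _ _ _ (X `&` [set x | x <> \bot%O])).
  apply: dmin => [x []//|y [_ y0]].
  by have [||x Xx [x0 xy]] := Xd y; rewrite ?lex1 //; exists x.
by apply: (card_le_trans _ XK); apply: subset_card_le => x [].
Qed.

Lemma maximal_antichain (D : set B) : (forall x, D x -> x <> \bot%O) ->
  exists A, [/\ antichain A, A `<=` D &
    forall x, D x -> exists2 a, A a & (a `&` x <> \bot)%O].
Proof.
move=> D0.
pose P (A : set B) := A `<=` D /\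
  forall x y, A x -> A y -> x <> y -> (x `&` y = \bot)%O.
have [F FP Ftot|A [[AD Ad] Amax]] := @Zorn_bigcup _ P.
  split=> [x [A FA]|x y [A FA Ax] [A' FA' Ay]]; first exact: (FP _ FA).1.
  have [s|s] := Ftot _ _ FA FA'.
    by apply: (FP _ FA').2 => //; exact: s.
  by apply: (FP _ FA).2 => //; exact: s.
exists A; split=> //; first by split=> // x /AD /D0.
move=> x Dx; apply: contrapT => nex.
have xd a : A a -> (a `&` x = \bot)%O.
  by move=> Aa; apply: contrapT => ax; apply: nex; exists a.
have nAx : ~ A x by move=> /xd; rewrite meetxx; exact: D0.
apply: (Amax (A `|` [set x])).
  by split=> [z|/(_ x) s]; [left|apply: nAx; apply: s; right].
split=> [z [/AD//|->//]|z w [Az|->] [Aw|->] // zw].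
- exact: Ad.
- exact: xd.
- by rewrite meetC; exact: xd.
Qed.

End BA.

(** * Chains and singular cardinals *)

Section Chains.
Context {d : Order.disp_t} {B : ctbDistrLatticeType d}.
Variables (L : Type) (R : rel L).
Hypotheses (Lcard : initial_ordinal R) (Linf : infinite_set [set: L]).
Implicit Types (x y z a c : B) (S X Q : set B) (i j : L).

Let wR : well_order R := Lcard.1.

Definition cofinal (A : set L) := forall i, exists2 a, A a & R i a.

Lemma segment_closed_le (K : set L) i : infinite_set K -> segment R i #<= K ->
  [set j | R j i] #<= K.
Proof.
move=> Kinf iK; apply: (@card_le_trans _ _ _ (segment R i `|` [set i])).
  by apply: subset_card_le => j /(segmentVeq wR)[|->]; [left|right].
by apply: card_leU_inf => //; have [] := finite_card_lt (finite_set1 i) Kinf.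
Qed.

(** Otherwise [L] would be a union of |T| segments whose sizes have a common bound below |L|. *)
Lemma singular_le U (T : set L) (X : set U) : infinite_set T -> T #< [set: L] ->
  cofinal T -> (forall i, T i -> segment R i #<= X) -> [set: L] #<= X.
Proof.
move=> Tinf TL Tcof TX; apply: contrapT => /not_card_le_lt XL.
have [K [Kinf TK XK KL]] := card_lt_common Tinf TL XL.
case: KL => _; apply.
apply: (@card_le_trans _ _ _ (\bigcup_(i in T) [set j | R j i])).
  by apply: subset_card_le => j _; have [i Ti ji] := Tcof j; exists i.
apply: card_le_bigcup => // i Ti; apply: segment_closed_le => //.
exact: card_le_trans (TX _ Ti) XK.
Qed.

(* The indices whose segment has size at most |K| form the successor cardinal
   of |K|, which is regular. *)
Lemma successor_regular U (K : set L) (A : set U) (f : U -> L) :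
  infinite_set K -> K #< [set: L] ->
  (forall u, A u -> segment R (f u) #<= K) ->
  (forall i, segment R i #<= K -> exists2 u, A u & R i (f u)) ->
  ~ (A #<= K).
Proof.
move=> Kinf KL AK Acof leAK; pose D := [set i | segment R i #<= K].
have DK : D #<= K.
  apply: (@card_le_trans _ _ _ (\bigcup_(u in A) [set j | R j (f u)])).
    by apply: subset_card_le => i /Acof[u Au iu]; exists u.
  by apply: card_le_bigcup => // u Au; apply: segment_closed_le => //; exact: AK.
have [DT|/existsNP nD] := pselect (forall i, D i).
  by case: KL => _; apply; apply: (card_le_trans _ DK); exact: subset_card_le.
(* The segment of the least [z] outside [D] is contained in [D], so its size is at most |K| and [z]
   belongs to [D]. *)
have [//|z nDz zmin] := wo_min wR (A := [set i | ~ D i]).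
apply: nDz; apply: (card_le_trans _ DK); apply: subset_card_le => j jz.
by apply: contrapT => /zmin; apply/negP.
Qed.

(** A left-separated sequence below [c]. Traces on [c] are used because [gen] takes complements in
    [B], which leave the part below [c]. *)
Definition left_chain c (b : L -> B) := forall i, [/\ b i <> \bot%O, (b i <= c)%O
  & forall x, gen (b @` segment R i) x -> (x `&` c <> \bot)%O -> ~ (x `&` c <= b i)%O].

(** If step [i] were impossible, the traces on [c] of the elements generated so far would be dense
    below [c], and there are at most |L| of them. *)
Lemma left_chain_ex c : ~ density_le c [set: L] -> exists b, left_chain c b.
Proof.
move=> nd; apply: (@wo_rec_ex _ _ wR _ \bot%O (fun i f u => [/\ u <> \bot%O, (u <= c)%O
  & forall x, gen (f @` segment R i) x -> (x `&` c <> \bot)%O -> ~ (x `&` c <= u)%O])).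
- move=> i f; apply: contrapT => nex; apply: nd.
  exists ((fun x => x `&` c)%O @` gen (f @` segment R i)).
    move=> y y0 yc; apply: contrapT => ny; apply: nex; exists y; split=> // x gx xc xy.
    by apply: ny; exists (x `&` c)%O; [exists x|].
  apply: (card_le_trans (card_image_le _ _)); apply: card_gen => //.
  exact: (card_le_trans (card_image_le _ _)) (card_leT _).
- move=> i f g u fg; suff -> : f @` segment R i = g @` segment R i by [].
  by apply/seteqP; split=> _ [j ji <-]; exists j => //; rewrite fg.
Qed.

(** Let [f x] bound the indices of generators needed for [x]. If [f x] comes before [i], then a
    positive [x] cannot lie below [b i]. *)
Lemma left_chain_unbounded c b (D : set L) X : left_chain c b ->
  (forall x, X x -> exists2 x', gen (b @` D) x' & x = (x' `&` c)%O) ->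
  (forall i, D i -> exists2 x, X x & x <> \bot%O /\ (x <= b i)%O) ->
  D !=set0 ->
  exists f : B -> L, (forall x, X x -> D (f x)) /\
    (forall i, D i -> exists2 x, X x & R i (f x)).
Proof.
move=> cb Xg Xd [i0 Di0].
have [f fP] : exists f : B -> L, forall x, X x -> D (f x) /\
    exists2 x', gen (b @` [set y | R y (f x)]) x' & x = (x' `&` c)%O.
  apply: (choice_on (P := fun x i => D i /\ exists2 x',
    gen (b @` [set y | R y i]) x' & x = (x' `&` c)%O) i0) => x /Xg[x' gx' ->].
  have := gen_directed (R := R) (b := b) (Q := set0) (D := D) wR.
  rewrite set0U => /(_ _ gx')[g0|[i Di gi]].
    by exists i0; split=> //; exists x' => //; apply: gen_mono g0.
  exists i; split=> //; exists x' => //; apply: gen_mono gi => z.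
  by rewrite set0U => -[y [_ yi] <-]; exists y.
exists f; split=> [x /fP[]//|i Di].
have [x Xx [x0 xi]] := Xd _ Di; exists x => //; have [_ [x' gx' xx']] := fP _ Xx.
apply: contrapT => /negP ni; have [_ _] := cb i; case/(_ x'); rewrite -?xx' //.
by apply: gen_mono gx' => _ [y yf <-]; exists y => //; exact: (segment_le_lt wR yf).
Qed.

Lemma realizes_density_regular : ~ density_le (\top : B)%O [set: L] ->
  (forall A, cofinal A -> [set: L] #<= A) -> realizes_density (B := B) L.
Proof.
move=> nd reg; have [b cb] := left_chain_ex nd.
apply: (realizes_densityI (S := range b)) => // [|X Xd]; first exact: card_image_le.
pose X' := X `&` gen (range b).
have [|||f [_ fcof]] := left_chain_unbounded (D := setT) (X := X') cb.
- by move=> x [_ gx]; exists x; rewrite ?meetx1.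
- move=> i _; have [b0 _ _] := cb i.
  have [||x Xx [gx x0 xb]] := Xd (b i) => //; last by exists x.
  by apply: gen_sub; exists i.
- by have [i _] := infinite_setN0 Linf; exists i.
apply: (card_le_trans (reg (f @` X') _)).
  by move=> i; have [//|x Xx ix] := fcof i; exists (f x) => //; exists x.
by apply: (card_le_trans (card_image_le _ _)); apply: subset_card_le => x [].
Qed.

Section Singular.
Variable T : set L.
Hypotheses (Tinf : infinite_set T) (TL : T #< [set: L]) (Tcof : cofinal T).

(** Take as generators a dense set below each such [c]. A set that is dense in the generated algebra
    is then dense in [B] below every [c]. *)
Lemma realizes_density_medium :
  (forall i, exists c : B, (forall X, dense_below c X -> segment R i #<= X) /\
     density_le c [set: L]) -> realizes_density (B := B) L.
Proof.
move=> ex.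
have [G GP] : exists G : L -> set B, forall i, setT i ->
    G i #<= [set: L] /\ exists2 c : B,
     (forall X, dense_below c X -> segment R i #<= X) & dense_below c (G i).
  apply: (choice_on (P := fun i G => G #<= [set: L] /\ exists2 c : B,
     (forall X, dense_below c X -> segment R i #<= X) & dense_below c G) set0) => i _.
  by have [c [cX [G Gd GL]]] := ex i; exists G; split=> //; exists c.
apply: (realizes_densityI (S := \bigcup_(i in setT) G i)) => // [|X Xd].
  by apply: card_le_bigcup => // i _; exact: (GP i I).1.
apply: (singular_le Tinf TL) => // i _.
have [_ [c cX cG]] := GP i I; apply: cX => y y0 yc.
have [g Gg [g0 gy]] := cG _ y0 yc.
have [||x Xx [_ x0 xg]] := Xd g => //; first by apply: gen_sub; exists i.
by exists x => //; split=> //; exact: le_trans xg gy.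
Qed.

(** Below the [i]-th member of the antichain runs a left chain along [D i], whose order type is the
    successor cardinal of |K i|. By regularity of that cardinal, a dense set has more than |K i|
    elements there. *)
Lemma realizes_density_big_antichain (A : set B) :
  antichain A -> (forall c, A c -> ~ density_le c [set: L]) -> T #<= A ->
  realizes_density (B := B) L.
Proof.
move=> [A0 Ad] Abig /(card_le_inj_ex \bot%O)[c cA cinj].
have [b bP] : exists b : L -> L -> B, forall i, T i -> left_chain (c i) (b i).
  apply: (choice_on (P := fun i b => left_chain (c i) b) (fun=> \bot%O)) => i Ti.
  by apply: left_chain_ex; apply: Abig; exact: cA.
pose K i := segment R i `|` T; pose D i := [set j | segment R j #<= K i].
have Kinf i : infinite_set (K i).
  by apply: (infinite_card_le Tinf); apply: subset_card_le => j; right.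
have KL i : K i #< [set: L] by apply: card_lt_setU => //; exact: Lcard.2.
have cd i j : T i -> T j -> i <> j -> (c i `&` c j = \bot)%O.
  by move=> Ti Tj ij; apply: Ad; [exact: cA|exact: cA|move=> /cinj e; exact/ij/e].
apply: (realizes_densityI (S := \bigcup_(i in T) b i @` D i)) => // [|X Xd].
  apply: card_le_bigcup => //; first by have [] := TL.
  by move=> i _; exact: (card_le_trans (card_image_le _ _)) (card_leT _).
set G := \bigcup_(i in T) b i @` D i in Xd *.
apply: (singular_le Tinf TL) => // i Ti.
(* Generators placed below another [c j] vanish on [c i], so only the [i]-th chain matters there. *)
have Grestr x : gen G x -> exists2 x', gen (b i @` D i) x' & (x `&` c i = x' `&` c i)%O.
  elim=> {x} [_ [j Tj [k Dk <-]]||x y _ [x' gx xx'] _ [y' gy yy']|x _ [x' gx xx']].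
  - have [ij|ij] := pselect (i = j).
      by subst j; exists (b i k) => //; apply: gen_sub; exists k.
    exists \bot%O; first exact: gen_bot.
    rewrite meet0x; apply: le_bot (cd _ _ Tj Ti _); last by move=> /esym.
    by apply: leI2 => //; have [] := bP _ Tj k.
  - by exists \bot%O => //; exact: gen_bot.
  - exists (x' `&` y')%O; first exact: gen_meet.
    by rewrite -[c i]meetxx meetACA xx' yy' meetACA.
  - exists (~` x')%O; first exact: gen_compl.
    exact: meet_compl_congr.
pose Xi := [set x | [/\ X x, gen G x & (x <= c i)%O]].
have [|||f [fD fcof]] := left_chain_unbounded (D := D i) (X := Xi) (bP i Ti).
- move=> x [_ gx /meet_idPl xc]; have [x' gx' e] := Grestr _ gx.
  by exists x' => //; rewrite -e xc.
- move=> k Dk; have [b0 bc _] := bP i Ti k.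
  have [||x Xx [gx x0 xb]] := Xd (b i k) => //.
    by apply: gen_sub; exists i => //; exists k.
  by exists x => //; split=> //; exact: le_trans xb bc.
- by exists i; apply: subset_card_le => j; left.
have nle := successor_regular (Kinf i) (KL i) fD fcof.
have [le|//] := card_le_total Xi (K i).
  by case: nle.
move=> le; apply: (@card_le_trans _ _ _ (K i)).
  by apply: subset_card_le => j; left.
by apply: (card_le_trans le); apply: subset_card_le => x [].
Qed.

End Singular.

End Chains.

(** * Independent chains *)

Section Independent.
Context {d : Order.disp_t} {B : ctbDistrLatticeType d}.
Implicit Types (x y z a c p : B) (S X Q N : set B).

Definition independent_below N p a := (a <= p)%O /\
  forall y, N y -> y <> \bot%O -> (y <= p)%O ->
    (y `&` a <> \bot)%O /\ (y `&` ~` a <> \bot)%O.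

(** The normal form of an element over one new generator, stated through its traces on [a] and on
    the complement of [a]: meets and complements act on each trace separately. *)
Lemma gen_adjoin S a x : gen (S `|` [set a]) x ->
  exists y z, [/\ gen S y, gen S z, (x `&` a = y `&` a)%O & (x `&` ~` a = z `&` ~` a)%O].
Proof.
elim=> {x} [x [Sx|->]||x x' _ [y [z [gy gz xy xz]]] _ [y' [z' [gy' gz' xy' xz']]]
  |x _ [y [z [gy gz xy xz]]]].
- by exists x, x; split=> //; exact: gen_sub.
- exists \top%O, \bot%O; rewrite meetxx meet1x meetxC meet0x; split=> //.
    by rewrite -compl0; exact/gen_compl/gen_bot.
  exact: gen_bot.
- by exists \bot%O, \bot%O; split=> //; exact: gen_bot.
- exists (y `&` y')%O, (z `&` z')%O; split; try exact: gen_meet.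
    by rewrite -[a]meetxx meetACA xy xy' meetACA.
  by rewrite -[(~` a)%O]meetxx meetACA xz xz' meetACA.
- by exists (~` y)%O, (~` z)%O; split; try exact: gen_compl; exact: meet_compl_congr.
Qed.

Section IndependentChain.
Variables (L : Type) (R : rel L).
Hypotheses (wR : well_order R).
Variables (Q : set B) (p a : L -> B).
Hypotheses (Qp : forall i, Q (p i))
  (ia : forall i, independent_below (gen (Q `|` a @` segment R i)) (p i) (a i)).

Let G i := gen (Q `|` a @` segment R i).

Let G_not_below i x : G i x -> x <> \bot%O -> ~ (x <= a i)%O.
Proof.
move=> Gx x0 xa; have [ap ind] := ia i.
by case: (ind _ Gx x0 (le_trans xa ap)) => _; apply; apply/le_disjP.
Qed.

(* A positive element built from the generators up to [g] dominates, as far as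
   the generators before [g] are concerned, one built from those only. *)
Let descend g x : gen (Q `|` a @` [set j | R j g]) x -> x <> \bot%O ->
  exists w, [/\ G g w, w <> \bot%O &
    forall j, segment R g j -> (x <= a j)%O -> (w <= a j)%O].
Proof.
move=> gx x0; have [ap ind] := ia g.
have Gp : G g (p g) by apply: gen_sub; left.
have Ga j : segment R g j -> G g (a j).
  by move=> jg; apply: gen_sub; right; exists j.
have /gen_adjoin[y [z [Gy Gz xy xz]]] : gen ((Q `|` a @` segment R g) `|` [set a g]) x.
  apply: gen_mono gx => z [Qx|[j /(segmentVeq wR)[jg|->] <-]]; first by left; left.
    by left; right; exists j.
  by right.
(* If [x] meets [a g], take the meet of [y] and [p g]: a part of it outside [a j] would be split by
   [a g], although its half inside [a g] lies below [x], hence below [a j]. Otherwise [x] is the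
   part of [z] outside [a g]. If [z] meets [p g], the meet of [z] and [p g] works likewise; if not,
   [z] equals [x]. *)
have [xa|xa] := pselect (x `&` a g = \bot)%O; last first.
  exists (y `&` p g)%O; split; first exact: gen_meet.
    by move=> yp; apply: xa; rewrite xy; apply: disj_le2 yp.
  move=> j jg xj; apply/le_disjP; apply: contrapT => w0.
  case: (ind (y `&` p g `&` ~` a j)%O) => //.
  - by apply: gen_meet; [exact: gen_meet|apply: gen_compl; exact: Ga].
  - by rewrite meetAC leIr.
  - move=> + _; apply; move/le_disjP: xj; apply: le_bot.
    rewrite lexI; apply/andP; split; last first.
      by apply: (le_trans (leIl _ _)); exact: leIr.
    apply: (@le_trans _ _ (y `&` a g)%O); last by rewrite -xy leIl.
    by rewrite lexI leIr andbT; do 2![apply: (le_trans (leIl _ _))]; exact: leIl.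
have {}xz : x = (z `&` ~` a g)%O.
  by rewrite -xz; apply/esym/meet_idPl/disjP.
have [zp|zp] := pselect (z `&` p g = \bot)%O.
  exists z; split=> //; first by move=> z0; apply: x0; rewrite xz z0 meet0x.
  suff -> : z = x by [].
  by rewrite xz; apply/esym/meet_idPl/disjP; apply: disj_le2 zp.
exists (z `&` p g)%O; split=> //; first exact: gen_meet.
move=> j jg xj; apply/le_disjP; apply: contrapT => w0.
case: (ind (z `&` p g `&` ~` a j)%O) => //.
- by apply: gen_meet; [exact: gen_meet|apply: gen_compl; exact: Ga].
- by rewrite meetAC leIr.
- move=> _; apply; move/le_disjP: xj; apply: le_bot.
  rewrite lexI xz lexI leIr andbT; apply/andP; split.
    by do 2![apply: (le_trans (leIl _ _))]; exact: leIl.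
  by apply: (le_trans (leIl _ _)); exact: leIr.
Qed.

(** Induction on the last generator index [g] used by [x]. No later [a j] lies above [x], and
    [descend] gives a [w] generated before [g] that is below every earlier [a j] above [x]; only [g]
    itself is added. *)
Lemma independent_chain_finite x : gen (Q `|` range a) x -> x <> \bot%O ->
  finite_set [set j | (x <= a j)%O].
Proof.
have Qfin y : gen Q y -> y <> \bot%O -> finite_set [set j | (y <= a j)%O].
  move=> gy y0; suff -> : [set j | (y <= a j)%O] = set0 by [].
  apply/seteqP; split=> // j /= yj; apply: (G_not_below _ y0 yj).
  by apply: gen_mono gy => w; left.
have fin : forall g y, gen (Q `|` a @` [set j | R j g]) y -> y <> \bot%O ->
    finite_set [set j | (y <= a j)%O].
  apply: (wo_ind wR) => g IH y gy y0; have [w [Gw w0 wP]] := descend gy y0.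
  apply: (@sub_finite_set _ _ ([set g] `|` [set j | (w <= a j)%O])).
    move=> j /= yj; have [jg|gj] := wo_total wR j g.
      have [lt|->] := segmentVeq wR jg; last by left.
      by right; exact: wP.
    have [lt|->] := segmentVeq wR gj; last by left.
    case: (G_not_below _ y0 yj); apply: gen_mono gy => z [Qz|[k kg <-]]; first by left.
    by right; exists k => //; exact: (segment_le_lt wR kg).
  rewrite finite_setU; split=> //.
  have [gw|[h hg gw]] := gen_directed wR Gw; first exact: Qfin.
  apply: (IH h) => //; apply: gen_mono gw => z [Qz|[k [_ kh] <-]]; first by left.
  by right; exists k.
move=> gx x0; have [gx'|[g _ gx']] := gen_directed wR gx; first exact: Qfin.
apply: (fin g) => //; apply: gen_mono gx' => z [Qz|[k [_ kg] <-]]; first by left.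
by right; exists k.
Qed.

End IndependentChain.

(** Every [a j] is positive, so it lies above a member of a dense set; each such member lies below
    finitely many [a j]. Hence a dense set has at least |L| elements. *)
Lemma realizes_density_independent (L : Type) (R : rel L) Q (p : L -> B) :
  well_order R -> infinite_set [set: L] -> Q #<= [set: L] ->
  (forall i, Q (p i) /\ p i <> \bot%O) ->
  (forall i (f : L -> B), exists a,
     independent_below (gen (Q `|` f @` segment R i)) (p i) a) ->
  realizes_density (B := B) L.
Proof.
move=> wR Linf QL Qp ex.
have [|i f g u fg|a aP] := @wo_rec_ex _ _ wR _ \bot%O (fun i f u =>
  independent_below (gen (Q `|` f @` segment R i)) (p i) u).
- exact: ex.
- suff -> : f @` segment R i = g @` segment R i by [].
  by apply/seteqP; split=> _ [j ji <-]; exists j => //; rewrite fg.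
have fin := independent_chain_finite wR (fun i => (Qp i).1) aP.
apply: (realizes_densityI (S := Q `|` range a)) => // [|X Xd].
  by apply: card_leU_inf => //; exact: card_image_le.
pose X' := X `&` [set x | gen (Q `|` range a) x /\ x <> \bot%O].
have LX : [set: L] `<=` \bigcup_(x in X') [set j | (x <= a j)%O].
  move=> j _; have [ap ind] := aP j.
  have [||x Xx [gx x0 xa]] := Xd (a j); last by exists x.
    by apply: gen_sub; right; exists j.
  have [pQ p0] := Qp j; case: (ind (p j)) => //; first by apply: gen_sub; left.
  by move=> + _ a0; apply; rewrite a0 meetx0.
have X'X : X' #<= X by apply: subset_card_le => x [].
apply: (card_le_trans _ X'X); have [X'fin|X'inf] := pselect (finite_set X').
  exfalso; apply: Linf; apply: (sub_finite_set LX); apply: bigcup_finite => // x.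
  by move=> [_ [gx x0]]; exact: fin.
apply: (card_le_trans (subset_card_le LX)); apply: card_le_bigcup => //.
by move=> x [_ [gx x0]]; have [] := finite_card_lt (fin _ gx x0) X'inf.
Qed.

End Independent.

(** * Elements below which every small algebra is split *)

Section SplittingPoint.
Context {d : Order.disp_t} {B : ctbDistrLatticeType d}.
Variables (L : Type) (R : rel L) (wR : well_order R).
Variable T : set L.
Hypotheses (Tinf : infinite_set T)
  (Treg : forall s : set L, s #< T -> exists2 i, T i & s `<=` segment R i).
Variables (U : Type) (K : set U).
Hypotheses (Kinf : infinite_set K) (TK : T #<= K) (KK : small_subsets T K #<= K).

(** Transfinite stages, indexed by [T], of the closure of the empty set under [F], where [F] is
    applied to sets smaller than [T]. *)
Inductive stage (F : set B -> set B) : L -> B -> Prop :=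
  Stage i s x : T i -> s #< T ->
    (forall e, s e -> exists2 j, segment R i j & stage F j e) ->
    F s x -> stage F i x.

(** By [KK] there are at most |K| small sets to treat at each stage; by [Treg] a small subset of the
    union is already contained in the stages before some member of [T]. *)
Lemma closure_ex (F : set B -> set B) : (forall s, s #< T -> F s #<= K) ->
  exists2 N : set B, N #<= K & forall s, s `<=` N -> s #< T -> F s `<=` N.
Proof.
move=> FK; pose N := \bigcup_(i in T) (stage F i : set B).
have stageP i x : stage F i x -> exists s, [/\ T i, s #< T,
    forall e, s e -> exists2 j, segment R i j & stage F j e & F s x].
  by case=> {}i s {}x Ti sT sj Fx; exists s.
have stageK : forall i, (stage F i : set B) #<= K.
  apply: (wo_ind wR) => i IH.
  pose M := \bigcup_(j in T `&` segment R i) (stage F j : set B).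
  have MK : M #<= K.
    apply: card_le_bigcup => // [|j [_ /IH]//].
    by apply: (card_le_trans _ TK); apply: subset_card_le => j [].
  apply: (@card_le_trans _ _ _ (\bigcup_(s in small_subsets T M) F s)).
    apply: subset_card_le => x /stageP[s [_ sT sj Fx]].
    exists s => //; split=> // e /sj[j ji ej]; exists j => //; split=> //.
    by have [? []] := stageP _ _ ej.
  apply: card_le_bigcup => // [|s [_ /FK]//].
  by apply: (card_le_trans _ KK); apply: card_le_small_subsets => //; exact: infinite_setN0.
exists N; first exact: card_le_bigcup.
move=> s sN sT x Fx; have [i0 _] := infinite_setN0 Tinf.
have [f fP] : exists f : B -> L, forall e, s e -> stage F (f e) e.
  by apply: (choice_on (P := fun e i => stage F i e) i0) => e /sN[i _]; exists i.
have [|i Ti ib] := Treg (s := f @` s).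
  exact: card_le_lt_trans (card_image_le _ _) sT.
exists i => //; apply: Stage sT _ Fx => // e se.
by exists (f e); [apply: ib; exists e|exact: fP].
Qed.

(** If every positive [p] below [c] had a counterexample [C p], then [N] could be closed under [C]
    as well. But some [p] in [N] has all of [N] below it split by one element, so [gen (C p)] is
    split too. *)
Lemma splitting_point_ex c :
  (forall A, antichain A -> (forall x, A x -> (x <= c)%O) -> ~ (T #<= A)) ->
  ~ ([set x : B | (x <= c)%O] #<= K) ->
  exists p, [/\ p <> \bot%O, (p <= c)%O &
    forall C : set B, C #<= K -> exists a, independent_below (gen C) p a].
Proof.
move=> cc cK; apply: contrapT => nex.
have [C CP] : exists C : B -> set B, forall p, setT p -> C p #<= K /\
    (p <> \bot%O -> (p <= c)%O -> forall a, ~ independent_below (gen (C p)) p a).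
  apply: (choice_on (P := fun p C => C #<= K /\ (p <> \bot%O -> (p <= c)%O ->
    forall a, ~ independent_below (gen C) p a)) set0) => p _.
  apply: contrapT => nC.
  have [p0|p0] := pselect (p = \bot%O).
    by apply: nC; exists set0; split=> //; exact: card_ge0.
  have [pc|pc] := pselect (p <= c)%O; last first.
    by apply: nC; exists set0; split=> //; exact: card_ge0.
  apply: nex; exists p; split=> // C CK; apply: contrapT => na.
  by apply: nC; exists C; split=> // _ _ a ia; apply: na; exists a.
(* [F1] picks a positive element below [c] disjoint from [s], and [F2] the supremum of [s]; both
   default to bottom. *)
pose F1 s := xget (\bot%O : B) [set p | [/\ p <> \bot%O, (p <= c)%O &
  forall x, s x -> (x `&` p = \bot)%O]].
pose lub (s : set B) u := (forall x, s x -> (x <= u)%O) /\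
  forall v, (forall x, s x -> (x <= v)%O) -> (u <= v)%O.
pose F2 s := xget (\bot%O : B) [set u | lub s u].
pose F s := gen (s `|` ([set F1 s; F2 s] `|` \bigcup_(p in s) C p)).
have finK V (A : set V) : finite_set A -> A #<= K.
  by move=> /finite_card_lt /(_ Kinf)[].
have [s sT|N NK Ncl] := closure_ex (F := F).
  have sK : s #<= K by apply: card_le_trans sT.1 TK.
  apply: card_gen => //; apply: card_leU_inf => //; apply: card_leU_inf => //.
    exact: finK.
  by apply: card_le_bigcup => // p _; have [] := CP p I.
have finT (A : set B) : finite_set A -> A #< T by move=> ?; exact: finite_card_lt.
have Nsub s : s `<=` N -> s #< T -> gen s `<=` N.
  by move=> sN sT; apply: subset_trans (Ncl _ sN sT); apply: gen_mono => x; left.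
have Nalg : subalgebra N.
  have N2 x y z : N x -> N y -> gen [set x; y] z -> N z.
    by move=> Nx Ny; apply: Nsub => [w [->|->]//|]; exact: finT.
  have N0 : N \bot%O.
    by apply: (Nsub set0) => //; [exact: finT|exact: gen_bot].
  have Nc x : N x -> N (~` x)%O.
    by move=> Nx; apply: (N2 x x) => //; apply: gen_compl; apply: gen_sub; left.
  split=> //; first by rewrite -compl0; exact: Nc.
  move=> x y Nx Ny.
  have gx : gen [set x; y] x by apply: gen_sub; left.
  have gy : gen [set x; y] y by apply: gen_sub; right.
  by split; apply: (N2 x y) => //; [exact: gen_meet|exact: gen_join].
have [a ac nNa] : exists2 a, (a <= c)%O & ~ N a.
  apply: contrapT => na; apply: cK; apply: (card_le_trans _ NK).
  by apply: subset_card_le => x xc; apply: contrapT => nNx; apply: na; exists x.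
have [|A0 [[A00 A0d] A0D A0max]] :=
  maximal_antichain (D := [set x | [/\ N x, x <> \bot%O & (x <= a)%O]]).
  by move=> x [].
have [|A1 [[A10 A1d] A1D A1max]] := maximal_antichain
  (D := [set x | [/\ N x, x <> \bot%O, (x <= c)%O & (x `&` a = \bot)%O]]).
  by move=> x [].
pose A := A0 `|` A1.
have Aa : antichain A.
  split=> [x [/A00|/A10]//|x y [Ax|Ax] [Ay|Ay] xy].
  - exact: A0d.
  - have [_ _ xa] := A0D _ Ax; have [_ _ _ ya] := A1D _ Ay.
    by rewrite meetC; apply: disj_le2 ya.
  - have [_ _ xa] := A0D _ Ay; have [_ _ _ ya] := A1D _ Ax.
    by apply: disj_le2 ya.
  - exact: A1d.
have AT : A #< T.
  apply: not_card_le_lt; apply: cc => // x [/A0D[_ _ xa]|/A1D[]//].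
  exact: le_trans xa ac.
have AN : A `<=` N by move=> x [/A0D[]|/A1D[]].
have A0T : A0 #< T by apply: card_le_lt_trans AT; apply: subset_card_le => x; left.
(* If nothing positive below [c] were disjoint from [A], then [a] would be the supremum of [A0]: for
   an upper bound [v], the part of [a] outside [v] is disjoint from [A0] and [A1]. So [a] would be
   in [N]. *)
have [p0 pc pd] : [/\ F1 A <> \bot%O, (F1 A <= c)%O &
    forall x, A x -> (x `&` F1 A = \bot)%O].
  apply: (@xgetPex _ _ [set p | [/\ p <> \bot%O, (p <= c)%O &
    forall x, A x -> (x `&` p = \bot)%O]]).
  apply: contrapT => np; apply: nNa.
  have aub : forall x, A0 x -> (x <= a)%O by move=> x /A0D[].
  have luba : lub A0 a.
    split=> // v vub; apply/le_disjP; apply: contrapT => av0; apply: np.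
    exists (a `&` ~` v)%O; split=> //; first exact: le_trans (leIl _ _) ac.
    move=> x [Ax|/A1D[_ _ _ xa]]; last by apply: disj_le2 xa => //; exact: leIl.
    by apply: disj_le2 (meetxC v); [exact: vub|exact: leIr].
  have [lub1 lub2] : lub A0 (F2 A0).
    by apply: (@xgetPex _ _ [set u | lub A0 u]); exists a.
  have -> : a = F2 A0.
    by apply: le_anti; rewrite luba.2 // lub2.
  apply: (Ncl A0) => //; first by move=> x Ax; apply: AN; left.
  by apply: gen_sub; right; left; right.
have Np : N (F1 A) by apply: (Ncl A) => //; apply: gen_sub; right; left; left.
have [_ /(_ p0 pc (a `&` F1 A)%O)] := CP (F1 A) I; apply.
split=> [|y gy y0 yp]; first exact: leIr.
have Ny : N y.
  move: gy; apply: gen_min => // x Cx.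
  apply: (Ncl [set F1 A]) => [_ ->//||]; first exact: finT.
  by apply: gen_sub; right; right; exists (F1 A).
(* If [y] missed [a], or lay below it, then maximality of [A1] or [A0] would make [y] meet [A], from
   which [F1 A] is disjoint. *)
split.
  rewrite meetCA (meet_idPl yp) meetC => ya.
  have [|a1 Aa1] := A1max y; first by split=> //; exact: le_trans yp pc.
  by apply; apply: disj_le2 (pd a1 _) => //; right.
move=> /le_disjP; rewrite lexI => /andP[ya _].
have [//|a0 Aa0] := A0max y; apply.
by apply: disj_le2 (pd a0 _) => //; left.
Qed.

End SplittingPoint.

(** * Families of subsets smaller than the cofinality *)

Section FamilyCode.
Variables (L V : Type).
Implicit Types (e : set V -> L) (S : set (set V)).

(* The pairs [(e s, None)] record which indices are used, so that an empty
   member of the family is not lost. *)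
Definition family_code e S : set (L * option V) :=
  \bigcup_(s in S) (pair (e s) @` (Some @` s `|` [set None])).

(** The part of the code with a fixed index is a copy of the member with that index, whichever
    indexing was used. *)
Lemma family_code_inj e e' S S' :
  (forall s t, S s -> S t -> e s = e t -> s = t) ->
  (forall s t, S' s -> S' t -> e' s = e' t -> s = t) ->
  family_code e S = family_code e' S' -> S = S'.
Proof.
have sub f f' X X' : (forall s t, X s -> X t -> f s = f t -> s = t) ->
  (forall s t, X' s -> X' t -> f' s = f' t -> s = t) ->
  family_code f X = family_code f' X' -> X `<=` X'.
  move=> finj finj' eX s Xs.
  have : family_code f X (f s, None) by exists s => //; exists None => //; right.
  rewrite eX => -[t Xt [_ _ [ft _]]].
  suff -> : s = t by [].
  apply/seteqP; split=> v sv.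
    have : family_code f X (f s, Some v).
      by exists s => //; exists (Some v) => //; left; exists v.
    rewrite eX => -[t' Xt' [o to [ft' eo]]]; rewrite eo in to; case: to => [[w tw [vw]]|//].
    by rewrite (finj' t t') ?ft // -vw.
  have : family_code f' X' (f' t, Some v).
    by exists t => //; exists (Some v) => //; left; exists v.
  rewrite -eX => -[s' Xs' [o so [fs' eo]]]; rewrite eo in so; case: so => [[w sw [vw]]|//].
  by rewrite (finj s s') ?fs' ?ft // -vw.
by move=> einj einj' eS; apply/seteqP; split; apply: sub; eauto.
Qed.

End FamilyCode.

Section Cofinality.
Variables (L : Type) (R : rel L).
Hypotheses (Lcard : initial_ordinal R) (Linf : infinite_set [set: L]).
Let wR : well_order R := Lcard.1.

Lemma no_maximum i : exists j, segment R j i.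
Proof.
apply: contrapT => nj; suff : [set: L] #< [set: L] by case.
apply: (@card_le_lt_trans _ _ _ _ (segment R i `|` [set i])).
  apply: subset_card_le => j _; have [||->] := @segmentVeq _ _ wR j i; try by [left|right].
  by have [//|ij] := wo_total wR j i; apply/segmentN => ji; apply: nj; exists j.
by apply: card_lt_setU => //; [exact: Lcard.2|exact: finite_card_lt].
Qed.

(* Among the elements of a cofinal set of minimal size, keep those exceeding
   all their predecessors in a well-ordering of minimal type. *)
Lemma thin_cofinal_ex : exists T : set L, [/\ T `<=` cofinality R,
  cofinal R T & forall i, T i -> T `&` segment R i #< T].
Proof.
have [Ccof Cmin] := cofinalityP wR.
set C := cofinality R in Ccof Cmin *.
have [R' [wR' R'ini]] := initial_ordinal_ex C.
pose T := [set t | exists2 a : C, t = val a &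
  forall b, segment R' a b -> segment R (val a) (val b)].
have Tcof : cofinal R T.
  move=> i; have [|a ia amin] := wo_min wR' (A := [set a : C | R i (val a)]).
    by have [x Cx ix] := Ccof i; exists (SigSub (mem_set Cx)).
  exists (val a) => //; exists a => // b /negP ba.
  apply: (segment_lt_le wR _ ia).
  by apply: contrapT => /(@not_segment _ _ _ _) ib; apply: ba; exact: amin.
have TC : T `<=` C by move=> _ [a -> _]; exact: (set_mem (valP a)).
have CT : C #<= T by apply: Cmin => i; exact: Tcof.
exists T; split=> // _ [a -> aP].
apply: (@card_lt_le_trans _ _ _ _ C) => //.
apply: (@card_le_lt_trans _ _ _ _ (segment R' a)).
  apply: (@card_le_trans _ _ _ (val @` segment R' a)); last exact: card_image_le.
  apply: subset_card_le => _ [[b -> bP] ba]; exists b => //.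
  apply: contrapT => /(@not_segment _ _ _ _) ab.
  have [lt|e] := segmentVeq wR' ab; last by rewrite e in ba; exact: segment_irr ba.
  have := segment_lt_le wR (bP _ lt) (segment_leW wR ba).
  exact: segment_irr.
by apply: card_lt_le_trans (R'ini a) _; have /card_eqPle[] := card_setT C.
Qed.

Variable T : set L.
Hypotheses (TC : T `<=` cofinality R)
  (Tcof : cofinal R T) (Tseg : forall i, T i -> T `&` segment R i #< T).

(** |T| is at most the cofinality, so a set smaller than [T] is not cofinal. *)
Lemma cofinal_bounded s : s #< T -> exists2 i, T i & s `<=` segment R i.
Proof.
move=> [_ nTs].
have [i ib] : exists i, forall j, s j -> ~ R i j.
  apply: contrapT => nex; apply: nTs; apply: (card_le_trans (subset_card_le TC)).
  have [_ Cmin] := cofinalityP wR; apply: Cmin => i; apply: contrapT => ni.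
  by apply: nex; exists i => j sj ij; apply: ni; exists j.
have [t Tt it] := Tcof i; exists t => // j sj.
apply: (segment_lt_le wR _ it); apply/negP; exact: ib.
Qed.

Lemma cofinal_infinite : infinite_set T.
Proof.
have [i0 _] := infinite_setN0 Linf; have [t0 Tt0 _] := Tcof i0.
have [f fP] : exists f : L -> L, forall t, setT t -> T (f t) /\ segment R (f t) t.
  apply: (choice_on (P := fun t u => T u /\ segment R u t) i0) => t _.
  have [j tj] := no_maximum t; have [u Tu ju] := Tcof j.
  by exists u; split=> //; exact: segment_lt_le tj ju.
pose g n := iter n f t0.
have gT n : T (g n) by case: n => [//|n]; have [] := fP (g n) I.
have glt m n : m < n -> segment R (g n) (g m).
  elim: n => // n IH; rewrite ltnS leq_eqVlt => /orP[/eqP->|/IH mn].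
    by have [] := fP (g n) I.
  by have [_ /(segment_leW wR)] := fP (g n) I; exact: segment_lt_le mn.
apply/infiniteP; apply: (card_le_inj (f := g)) => // m n _ _ e.
have [mn|mn|//] := ltngtP m n; have := glt _ _ mn; by rewrite e => /(segment_irr wR).
Qed.

(** Regularity of |T|: were the union mapped onto [T], the image of each piece would be bounded, and
    so would the set of these bounds. *)
Lemma card_lt_bigcup_cofinal V W (J : set V) (s : V -> set W) : J #< T ->
  (forall j, J j -> s j #< T) -> \bigcup_(j in J) s j #< T.
Proof.
move=> JT sT; apply: not_card_le_lt => le.
have [t0 Tt0] := infinite_setN0 cofinal_infinite.
have [g gT gsurj] := card_le_surj_ex Tt0 le.
have [h hP] : exists h : V -> L, forall j, J j -> T (h j) /\ g @` s j `<=` segment R (h j).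
  apply: (choice_on (P := fun j i => T i /\ g @` s j `<=` segment R i) t0) => j Jj.
  have [|i Ti si] := @cofinal_bounded (g @` s j); last by exists i.
  exact: card_le_lt_trans (card_image_le _ _) (sT _ Jj).
have [|i Ti hi] := @cofinal_bounded (h @` J).
  exact: card_le_lt_trans (card_image_le _ _) JT.
have [u [j Jj su] gu] := gsurj _ Ti; have [_ hj] := hP _ Jj.
have ij : segment R (h j) i by apply: hj; exists u.
have ji : segment R i (h j) by apply: hi; exists j.
apply: (segment_irr wR); exact: (segment_lt_le wR ij (segment_leW wR ji)).
Qed.

Lemma family_code_lt V (e : set V -> L) (S : set (set V)) : S #< T ->
  (forall s, S s -> s #< T) -> family_code e S #< T.
Proof.
move=> ST sT; apply: card_lt_bigcup_cofinal => // s Ss.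
apply: card_le_lt_trans (card_image_le _ _) _; apply: card_lt_setU.
- exact: cofinal_infinite.
- exact: card_le_lt_trans (card_image_le _ _) (sT _ Ss).
- by apply: finite_card_lt => //; exact: cofinal_infinite.
Qed.

Lemma family_code_sub V (M : set V) (e : set V -> L) (S : set (set V)) :
  (forall s, S s -> T (e s)) -> (forall s, S s -> s `<=` M) ->
  family_code e S `<=` T `*` (Some @` M `|` [set None]).
Proof.
move=> eT SM _ [s Ss [_ [[v sv <-]|->] <-]]; split=> /=; try exact: eT; last by right.
by left; exists v => //; exact: SM sv.
Qed.

Lemma family_code_card V (M : set V) : infinite_set M -> T #<= M ->
  T `*` (Some @` M `|` [set None]) #<= M.
Proof.
move=> Minf TM; apply: card_leX_inf => //; apply: card_leU_inf => //.
  exact: card_image_le.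
by have [] := finite_card_lt (finite_set1 (None : option V)) Minf.
Qed.

(** A small family of small sets is coded by one small subset of a set of size |M|. *)
Lemma small_subsets_idem V (M : set V) : infinite_set M -> T #<= M ->
  small_subsets T (small_subsets T M) #<= small_subsets T M.
Proof.
move=> Minf TM; have M0 := infinite_setN0 Minf.
have [t0 _] := infinite_setN0 cofinal_infinite.
apply: (card_le_trans _ (card_le_small_subsets T M0 (family_code_card Minf TM))).
apply: (card_le_rel (r := fun S c => exists2 e : set V -> L,
  (forall s t, S s -> S t -> e s = e t -> s = t) & c = family_code e S)).
  move=> S [SM ST]; have [e eT einj] := card_le_inj_ex t0 ST.1.
  exists (family_code e S); last by exists e.
  split; first by apply: family_code_sub => // s /SM[].
  by apply: family_code_lt => // s /SM[].
by move=> S S' _ _ _ [e einj ->] [e' einj']; exact: family_code_inj.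
Qed.

(** The same coding; the sets in the family are arbitrary subsets of [M], and so is the code. *)
Lemma small_subsets_subsets V (M : set V) : infinite_set M -> T #<= M ->
  small_subsets T (subsets_of M) #<= subsets_of M.
Proof.
move=> Minf TM; have M0 := infinite_setN0 Minf.
have [t0 _] := infinite_setN0 cofinal_infinite.
apply: (card_le_trans _ (card_le_subsets_of M0 (family_code_card Minf TM))).
apply: (card_le_rel (r := fun S c => exists2 e : set V -> L,
  (forall s t, S s -> S t -> e s = e t -> s = t) & c = family_code e S)).
  move=> S [SM ST]; have [e eT einj] := card_le_inj_ex t0 ST.1.
  exists (family_code e S); last by exists e.
  by apply: family_code_sub => // s /SM.
by move=> S S' _ _ _ [e einj ->] [e' einj']; exact: family_code_inj.
Qed.

Lemma card_le_small_subsets_id V (M : set V) : M #<= small_subsets T M.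
Proof.
apply: (card_le_inj (f := set1)) => [m Mm|m m' _ _ e].
  by split=> [_ ->//|]; apply: finite_card_lt => //; exact: cofinal_infinite.
by have : [set m'] m by rewrite -e.
Qed.

(** A set smaller than [T] injects into some initial part [N i] of [T], so if nonempty it is the
    range of a function from [N i] to [M]. Each [N i] is smaller than the cofinality, and there are
    |T| of them. *)
Lemma small_subsets_weak_power (M : set L) : T #< [set: L] ->
  weak_power M (cofinality R) #< [set: L] -> small_subsets T M #< [set: L].
Proof.
move=> TL WL; have [K [Kinf TK WK KL]] := card_lt_common cofinal_infinite TL WL.
apply: card_le_lt_trans KL; pose N i := T `&` segment R i.
pose F i := range (fun (h : N i -> M) => [set m | exists n, val (h n) = m]).
apply: (@card_le_trans _ _ _ ([set set0] `|` \bigcup_(i in T) F i)); last first.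
  apply: card_leU_inf => //; first by have [] := finite_card_lt (finite_set1 (@set0 L)) Kinf.
  apply: card_le_bigcup => // i Ti; apply: (card_le_trans (card_image_le _ _)).
  apply: (card_le_trans _ WK); have [+ _] := weak_powerP M (cofinality R); apply.
  exact: card_lt_le_trans (Tseg Ti) (subset_card_le TC).
apply: subset_card_le => s [sM sT].
have [[m0 sm0]|s0] := pselect (s !=set0); last first.
  by left; apply/seteqP; split=> // m sm; case: s0; exists m.
right; have [e eT einj] := card_le_inj_ex m0 sT.1.
have [|i Ti ei] := @cofinal_bounded (e @` s).
  exact: card_le_lt_trans (card_image_le _ _) sT.
have sN : s #<= N i.
  by apply: (card_le_inj (f := e)) => // m sm; split; [exact: eT|apply: ei; exists m].
have [g gs gsurj] := card_le_surj_ex sm0 sN.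
exists i => //; exists (fun n : N i => SigSub (mem_set (sM _ (gs (val n))))) => //.
apply/seteqP; split=> m /=; first by move=> [n <-]; exact: gs.
move=> /gsurj[n Nn <-]; by exists (SigSub (mem_set Nn)).
Qed.

End Cofinality.

(** * The singular case *)

Section SingularCase.
Context {d : Order.disp_t} {B : ctbDistrLatticeType d}.
Variables (L : Type) (R : rel L).
Hypotheses (Lcard : initial_ordinal R) (Linf : infinite_set [set: L]).
Variable T : set L.
Hypotheses (TC : T `<=` cofinality R) (Tcof : cofinal R T)
  (TL : T #< [set: L]).
Implicit Types (x y z a c p : B) (S X Q N : set B).

Let wR : well_order R := Lcard.1.
Let Tinf : infinite_set T := cofinal_infinite Lcard Linf Tcof.
Let Treg := cofinal_bounded Lcard TC Tcof.

Definition hereditarily_big c :=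
  forall c', c' <> \bot%O -> (c' <= c)%O -> ~ density_le c' [set: L].

Lemma small_or_hereditarily_big y : y <> \bot%O -> exists x,
  [/\ x <> \bot%O, (x <= y)%O & density_le x [set: L] \/ hereditarily_big x].
Proof.
move=> y0; have [[x [x0 xy xs]]|nex] := pselect (exists x,
    [/\ x <> \bot%O, (x <= y)%O & density_le x [set: L]]).
  by exists x; split=> //; left.
by exists y; split=> //; right=> x x0 xy xs; apply: nex; exists x.
Qed.

(** Otherwise the elements of density at most |L| are dense in [B]. A maximal antichain of them has
    at most |L| members, and dense sets below these together form a dense set for [B]. *)
Lemma hereditarily_big_ex : ~ realizes_density (B := B) L ->
  ~ density_le (\top : B)%O [set: L] -> exists2 c, c <> \bot%O & hereditarily_big c.
Proof.
move=> nreal ntop; apply: contrapT => nex.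
have [|A [Aa AD Amax]] := maximal_antichain
  (D := [set x : B | x <> \bot%O /\ density_le x [set: L]]); first by move=> x [].
have AL : A #<= [set: L].
  by have [//|LA] := card_le_total A [set: L]; case: nreal; exact: realizes_density_antichain LA.
have [F FP] : exists F : B -> set B, forall x, A x ->
    dense_below x (F x) /\ F x #<= [set: L].
  apply: (choice_on (P := fun x F => dense_below x F /\ F #<= [set: L]) set0).
  by move=> x /AD[_ [F ? ?]]; exists F.
apply: ntop; exists (\bigcup_(x in A) F x); last first.
  by apply: card_le_bigcup => // x /FP[].
move=> y y0 _; have [x [x0 xy [xs|xb]]] := small_or_hereditarily_big y0; last first.
  by case: nex; exists x.
have [//|c Ac cx] := Amax x; have [Fd _] := FP _ Ac.
have [//||z Fz [z0 zcx]] := Fd (c `&` x)%O; first exact: leIl.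
exists z; first by exists c.
by split=> //; apply: le_trans zcx _; apply: le_trans (leIr _ _) xy.
Qed.

Lemma hereditarily_big_antichain c A : ~ realizes_density (B := B) L ->
  hereditarily_big c -> antichain A -> (forall x, A x -> (x <= c)%O) -> ~ (T #<= A).
Proof.
move=> nreal cb Aa Ac TA; apply: nreal.
apply: (realizes_density_big_antichain Lcard Linf Tinf TL Tcof Aa) => // x Ax.
by apply: cb; [exact: Aa.1|exact: Ac].
Qed.

Lemma hereditarily_big_card c : c <> \bot%O -> hereditarily_big c ->
  ~ ([set x : B | (x <= c)%O] #<= [set: L]).
Proof.
move=> c0 cb le; apply: (cb c) => //; exists [set x : B | (x <= c)%O] => // y y0 yc.
by exists y.
Qed.

(** There are no atoms below [c], since an atom has density one. A strictly decreasing sequence from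
    [c] has disjoint positive successive differences. *)
Lemma infinite_antichain c : c <> \bot%O -> hereditarily_big c ->
  exists A : set B, [/\ antichain A, forall x, A x -> (x <= c)%O & [set: nat] #<= A].
Proof.
move=> c0 cb; pose D := [set x : B | x <> \bot%O /\ (x <= c)%O].
have [f fP] : exists f : B -> B, forall y, D y ->
    [/\ D (f y), (f y <= y)%O & (y `&` ~` f y <> \bot)%O].
  apply: (choice_on (P := fun y z =>
    [/\ D z, (z <= y)%O & (y `&` ~` z <> \bot)%O]) \bot%O) => y [y0 yc].
  apply: contrapT => nex; apply: (cb y y0 yc); exists [set y]; last first.
    by have [] := finite_card_lt (finite_set1 y) Linf.
  move=> z z0 zy; exists y => //; split=> //; apply/le_disjP; apply: contrapT => yz.
  by apply: nex; exists z; split=> //; split=> //; exact: le_trans zy yc.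
pose g n := iter n f c; pose e n := (g n `&` ~` g n.+1)%O.
have gD n : D (g n) by elim: n => [|n /fP[]].
have gle m n : m <= n -> (g n <= g m)%O.
  elim: n => [|n IH]; first by rewrite leqn0 => /eqP->.
  rewrite leq_eqVlt => /orP[/eqP->//|/IH]; apply: le_trans.
  by have [] := fP _ (gD n).
have e0 n : e n <> \bot%O by have [] := fP _ (gD n).
have ed m n : m < n -> (e m `&` e n = \bot)%O.
  move=> mn; rewrite meetC; apply: disj_le2 (meetxC (g m.+1)); last exact: leIr.
  exact: le_trans (leIl _ _) (gle _ _ mn).
exists (range e); split.
- split=> [_ [n _ <-]//|_ _ [m _ <-] [n _ <-] mn].
  have [lt|lt|eq] := ltngtP m n; [exact: ed|by rewrite meetC; exact: ed|].
  by case: mn; rewrite eq.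
- by move=> _ [n _ <-]; apply: le_trans (leIl _ _) _; have [] := gD n.
- apply: (card_le_inj (f := e)) => [n _|m n _ _ emn]; first by exists n.
  have [lt|lt|//] := ltngtP m n; have := ed _ _ lt; rewrite emn meetxx => /e0 //.
Qed.

Lemma realizes_density_small_subsets c : c <> \bot%O -> hereditarily_big c ->
  (forall M : set L, M #< [set: L] -> small_subsets T M #< [set: L]) ->
  realizes_density (B := B) L.
Proof.
move=> c0 cb sL; apply: contrapT => nreal.
pose M i := segment R i `|` T; pose K i := small_subsets T (M i).
have ML i : M i #< [set: L] by apply: card_lt_setU => //; exact: Lcard.2.
have TM i : T #<= M i by apply: subset_card_le => j; right.
have Minf i : infinite_set (M i) by exact: infinite_card_le (TM i).
have MK i : M i #<= K i by exact: (card_le_small_subsets_id Lcard Linf Tcof).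
have Kinf i : infinite_set (K i) by exact: infinite_card_le (MK i).
have TK i : T #<= K i by exact: card_le_trans (TM i) (MK i).
have [q qP] : exists q : L -> B, forall i, setT i -> q i <> \bot%O /\
    forall C : set B, C #<= K i -> exists a, independent_below (gen C) (q i) a.
  apply: (choice_on (P := fun i q => q <> \bot%O /\ forall C : set B, C #<= K i ->
    exists a, independent_below (gen C) q a) \bot%O) => i _.
  have KK := small_subsets_idem Lcard Linf TC Tcof (Minf i) (TM i).
  have [||p [p0 _ pC]] := splitting_point_ex wR Tinf Treg (Kinf i) (TK i) KK (c := c).
  - by move=> A; exact: hereditarily_big_antichain.
  - move=> cK; apply: (hereditarily_big_card c0 cb); apply: (card_le_trans cK).
    by have [] := sL _ (ML i).
  - by exists p.
(* Step [i] works below [q (h i)] with [h i] in [T]. Only |T| points then have to be put into the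
   algebra in advance, so its size at step [i] is at most |K (h i)|. *)
have [h hP] : exists h : L -> L, forall i, setT i -> T (h i) /\ R i (h i).
  have [i0 _] := infinite_setN0 Linf.
  apply: (choice_on (P := fun i j => T j /\ R i j) i0) => i _.
  by have [j] := Tcof i; exists j.
apply: nreal; apply: (realizes_density_independent (p := q \o h) (Q := q @` T) wR Linf).
- by apply: (card_le_trans (card_image_le _ _)); have [] := TL.
- move=> i; have [Th _] := hP i I; split; first by exists (h i).
  by have [] := qP (h i) I.
- move=> i f; have [_] := qP (h i) I; apply; apply: card_leU_inf => //.
    exact: card_le_trans (card_image_le _ _) (TK _).
  apply: (card_le_trans (card_image_le _ _)); apply: card_le_trans (MK _).
  apply: subset_card_le => j ji; left; have [_ ih] := hP i I.
  exact: segment_lt_le ji ih.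
Qed.

(** The whole construction stays within size 2^|M|, so one splitting point for the power set of [M]
    serves all steps. *)
Lemma realizes_density_large_power c (M : set L) : hereditarily_big c ->
  T #<= M -> [set: L] #<= subsets_of M ->
  ~ ([set x : B | (x <= c)%O] #<= subsets_of M) -> realizes_density (B := B) L.
Proof.
move=> cb TM LM cM; apply: contrapT => nreal.
have Minf : infinite_set M by exact: infinite_card_le TM.
have Kinf : infinite_set (subsets_of M) by exact: infinite_card_le LM.
have TK : T #<= subsets_of M by exact: card_le_trans TL.1 LM.
have KK := small_subsets_subsets Lcard Linf Tcof Minf TM.
have [|//|p [p0 _ pC]] := splitting_point_ex wR Tinf Treg Kinf TK KK (c := c).
  by move=> A; exact: hereditarily_big_antichain.
apply: nreal.
apply: (realizes_density_independent (p := fun=> p) (Q := [set p]) wR Linf) => //.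
  by have [] := finite_card_lt (finite_set1 p) Linf.
move=> i f; apply: pC; apply: card_leU_inf => //.
  by have [] := finite_card_lt (finite_set1 p) Kinf.
by apply: (card_le_trans (card_image_le _ _)); exact: card_le_trans (card_leT _) LM.
Qed.

(** An element below [c] is determined by the members of a dense set that lie below it. *)
Lemma card_le_down_dense U c (K : set U) : K !=set0 -> density_le c K ->
  [set x : B | (x <= c)%O] #<= subsets_of K.
Proof.
move=> K0 [X Xd XK]; apply: (card_le_trans _ (card_le_subsets_of K0 XK)).
apply: (card_le_inj (f := fun y => [set x | [/\ X x, x <> \bot%O & (x <= y)%O]])).
  by move=> y _ x [].
have sub y y' : (y <= c)%O -> [set x | [/\ X x, x <> \bot%O & (x <= y)%O]] `<=`
    [set x | [/\ X x, x <> \bot%O & (x <= y')%O]] -> (y <= y')%O.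
  move=> yc s; apply/le_disjP; apply: contrapT => yy.
  have [//||x Xx [x0 xy]] := Xd (y `&` ~` y')%O; first exact: le_trans (leIl _ _) yc.
  have [|_ _ xy'] := s x; first by split=> //; exact: le_trans xy (leIl _ _).
  apply: x0; apply: le_bot (meetxC y'); rewrite lexI xy' /=.
  exact: le_trans xy (leIr _ _).
move=> y y' yc yc' /= e; apply: le_anti.
by apply/andP; split; apply: sub => //; rewrite e.
Qed.

Lemma card_lt_segment (M : set L) : M #< [set: L] -> exists i, M #<= segment R i.
Proof.
move=> ML; apply: contrapT => nex; case: ML => _; apply.
apply: (singular_le Lcard Tinf TL Tcof) => i _.
have [Mi|//] := card_le_total M (segment R i).
by case: nex; exists i.
Qed.

(** Otherwise a single [M] smaller than [L] bounds the part of [B] below each member of a maximal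
    antichain [A] by 2^|M|. Elements of [B] are determined by their traces on [A], so |B| is at most
    2^|M|. *)
Lemma hereditarily_big_power_ex : ~ realizes_density (B := B) L ->
  (forall M : set L, M #< [set: L] -> ~ ([set: B] #<= subsets_of M)) ->
  exists2 c, hereditarily_big c &
    forall M : set L, M #< [set: L] -> ~ ([set x : B | (x <= c)%O] #<= subsets_of M).
Proof.
move=> nreal BM; apply: contrapT => nex.
(* As [realizes_density_medium] cannot apply, the densities that are at most |L| are all bounded by
   one segment. *)
have [i0 i0P] : exists i, forall c : B, density_le c [set: L] ->
    density_le c (segment R i).
  apply: contrapT => ni; apply: nreal.
  apply: (realizes_density_medium Lcard Linf Tinf TL Tcof) => i.
  apply: contrapT => nc; apply: ni; exists i => c cL; apply: contrapT => nci.
  apply: nc; exists c; split=> // X Xd.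
  have [//|Xi] := card_le_total (segment R i) X.
  by case: nci; exists X.
have [|A [Aa AD Amax]] := maximal_antichain (D := [set x : B |
  x <> \bot%O /\ (density_le x [set: L] \/ hereditarily_big x)]); first by move=> x [].
have AL : A #< [set: L].
  apply: not_card_le_lt => LA; apply: nreal; exact: realizes_density_antichain LA.
pose A2 := A `&` hereditarily_big.
have [s sP] : exists s : B -> L, forall c, A2 c ->
    [set x : B | (x <= c)%O] #<= subsets_of (segment R (s c) `|` T).
  apply: (choice_on (P := fun c i =>
    [set x : B | (x <= c)%O] #<= subsets_of (segment R i `|` T)) i0) => c [Ac cb].
  apply: contrapT => ni; apply: nex; exists c => // M ML cM; apply: ni.
  have [i Mi] := card_lt_segment ML; exists i; apply: (card_le_trans cM).
  apply: card_le_subsets_of.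
    by have [t Tt] := infinite_setN0 Tinf; exists t; right.
  by apply: (card_le_trans Mi); apply: subset_card_le => j; left.
(* By [realizes_density_big_antichain] the set [A2] is smaller than [T], so the indices [s c] have a
   common bound. *)
have [|i1 _ i1P] := @Treg (s @` A2).
  apply: card_le_lt_trans (card_image_le _ _) _; apply: not_card_le_lt => TA.
  apply: nreal.
  apply: (realizes_density_big_antichain Lcard Linf Tinf TL Tcof (A := A2)) => //.
    by split=> [x [/(Aa.1)]|x y [Ax _] [Ay _]] //; exact: Aa.2.
  by move=> c [Ac cb]; apply: cb => //; exact: Aa.1.
have /card_subP[A' /card_eqPle[A'A AA'] _] := AL.1.
pose M := (segment R i0 `|` segment R i1) `|` (T `|` A').
have ML : M #< [set: L].
  apply: card_lt_setU => //; apply: card_lt_setU => //; try exact: Lcard.2.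
  exact: card_le_lt_trans A'A AL.
have [t Tt] := infinite_setN0 Tinf.
have TM : T `<=` M by move=> j; right; left.
have Minf : infinite_set M.
  by apply: infinite_card_le Tinf _; exact: subset_card_le.
have M0 : M !=set0 by exists t; exact: TM.
have dM c : A c -> [set x : B | (x <= c)%O] #<= subsets_of M.
  move=> Ac; have [_ [/i0P [X Xd Xi0]|cb]] := AD _ Ac.
    apply: card_le_down_dense => //; exists X => //; apply: (card_le_trans Xi0).
    by apply: subset_card_le => j; left; left.
  apply: (card_le_trans (sP c _)) => //; apply: card_le_subsets_of => //.
  apply: subset_card_le => j [js|]; last exact: TM.
  left; right; apply: (segment_lt_le wR js); apply: (segment_leW wR).
  by apply: i1P; exists c.
have [f fP] : exists f : B -> B -> set L, forall c, A c ->
    (forall x, (x <= c)%O -> f c x `<=` M) /\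
    (forall x y, (x <= c)%O -> (y <= c)%O -> f c x = f c y -> x = y).
  apply: (choice_on (P := fun c f => (forall x, (x <= c)%O -> f x `<=` M) /\
    (forall x y, (x <= c)%O -> (y <= c)%O -> f x = f y -> x = y)) (fun=> set0)) => c Ac.
  by have [f f1 f2] := card_le_inj_ex set0 (dM _ Ac); exists f.
apply: (BM M ML).
have AMM : A `*` M #<= M.
  apply: card_leX_inf => //; apply: (card_le_trans AA').
  by apply: subset_card_le => j; right; right.
apply: (card_le_trans _ (card_le_subsets_of M0 AMM)).
apply: (card_le_inj (f := fun b => [set q | A q.1 /\ f q.1 (b `&` q.1)%O q.2])).
  move=> b _ [c m] [/= Ac fm]; split=> //; apply: (fP _ Ac).1 fm; exact: leIr.
move=> b b' _ _ e.
have eA c : A c -> (b `&` c = b' `&` c)%O.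
  move=> Ac; have [_ finj] := fP _ Ac; apply: finj; try exact: leIr.
  apply/seteqP; split=> m fm.
    have : [set q | A q.1 /\ f q.1 (b `&` q.1)%O q.2] (c, m) by [].
    by rewrite e => -[].
  have : [set q | A q.1 /\ f q.1 (b' `&` q.1)%O q.2] (c, m) by [].
  by rewrite -e => -[].
(* A positive part of [u] outside [v] would contain a small or hereditarily big element, which meets
   a member of [A]. *)
have sub u v : (forall c, A c -> (u `&` c = v `&` c)%O) -> (u <= v)%O.
  move=> uv; apply/le_disjP; apply: contrapT => uv0.
  have [x [x0 xuv xD]] := small_or_hereditarily_big uv0.
  have [//|c Ac] := Amax x; apply; apply: (@le_bot _ _ _ (u `&` c `&` ~` v)%O).
    rewrite !lexI leIl andbT; apply/andP; split; apply: le_trans (leIr _ _) _;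
      apply: le_trans xuv _; [exact: leIl|exact: leIr].
  by rewrite (uv _ Ac) meetAC meetxC meet0x.
by apply: le_anti; apply/andP; split; apply: sub => c /eA.
Qed.

End SingularCase.

(* lambda is the initial ordinal (L, R); the cardinals mu < lambda are the
   cardinalities of the sets M : set L with M #< [set: L]. *)
Theorem theorem2p10 (d : Order.disp_t) (B : ctbDistrLatticeType d)
    (L : Type) (R : rel L)
    (Lcard : initial_ordinal R) (Linf : infinite_set [set: L])
    (piB : [set: L] #< alg_density [set: B])
    (hyp :
      (* (A) *) cofinality R #= [set: nat] \/
      (* (B) *) (forall M : set L, M #< [set: L] ->
                  weak_power M (cofinality R) #< [set: L]) \/
      (* (C) *) (forall M : set L, M #< [set: L] ->
                  [set: M -> bool] #< alg_density [set: B]) \/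
                (forall M : set L, M #< [set: L] ->
                  [set: M -> bool] #< [set: B])) :
  exists B' : set B,
    [/\ subalgebra B', alg_density B' #= [set: L] & B' #= [set: L]].
Proof.
have ntop := density_le_top piB.
have [T [TC Tcof Tseg]] := thin_cofinal_ex Lcard.
have wR := Lcard.1.
apply: contrapT => nreal.
(* If [T] had size |L|, then so would every cofinal set: the regular case. *)
have TL : T #< [set: L].
  apply: not_card_le_lt => LT; apply: nreal; apply: realizes_density_regular Lcard Linf ntop _.
  move=> A Acof; apply: (card_le_trans LT); apply: (card_le_trans (subset_card_le TC)).
  by have [_] := cofinalityP wR; apply.
have [c c0 cb] := hereditarily_big_ex Linf nreal ntop.
(* Both forms of (C) reduce to this one, since the density of [B] is at most |B|. *)
have powerC : (forall M : set L, M #< [set: L] -> [set: M -> bool] #< [set: B]) -> False.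
  move=> hC.
  have [M ML LM] : exists2 M : set L, M #< [set: L] & [set: L] #<= subsets_of M.
    (* Otherwise |L| is a strong limit, and [M] has at most 2^|M| < |L| small subsets. *)
    apply: contrapT => nM; apply: nreal.
    apply: (realizes_density_small_subsets Lcard Linf TC Tcof TL c0 cb) => M ML.
    apply: (@card_le_lt_trans _ _ _ _ (subsets_of M)).
      by apply: subset_card_le => s [].
    by apply: not_card_le_lt => LM; apply: nM; exists M.
  have [|c' cb' cM'] := hereditarily_big_power_ex Lcard Linf TC Tcof TL nreal.
    move=> N /hC[_ nle] BN; apply: nle; apply: (card_le_trans BN).
    exact: card_le_subsets_bool.
  have Tinf := cofinal_infinite Lcard Linf Tcof.
  apply: nreal.
  apply: (realizes_density_large_power Lcard Linf TC Tcof TL (M := M `|` T) cb').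
  - by apply: subset_card_le => j; right.
  - apply: (card_le_trans LM); apply: subset_card_le => s sM j /sM; by left.
  - by apply: cM'; exact: card_lt_setU.
case: hyp => [hA|[hB|[hC|hC]]].
- have [A [Aa Ac NA]] := infinite_antichain Linf c0 cb.
  apply: (hereditarily_big_antichain Lcard Linf Tcof TL nreal cb Aa Ac).
  apply: (card_le_trans (subset_card_le TC)); have /card_eqPle[CN _] := hA.
  exact: card_le_trans CN NA.
- apply: nreal; apply: (realizes_density_small_subsets Lcard Linf TC Tcof TL c0 cb) => M ML.
  exact: (small_subsets_weak_power Lcard Linf TC Tcof Tseg TL (hB _ ML)).
- apply: powerC => M /hC ltM; exact: card_lt_le_trans ltM (card_leT _).
- exact: powerC.
Qed.
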